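(* Let $K$ be a field, let $\mathbb{X}\subseteq\mathbb{P}^n_K$ be a $0$-dimensional locally Gorenstein scheme with no point of $\mathrm{Supp}(\mathbb{X})$ on the hyperplane $X_0=0$, and let $\sigma$ be a homogeneous trace map of degree zero of $Q^h(R)/L_0$. Then $$\mathfrak{F}_{\widetilde R/R}^2\subseteq\delta^\sigma_{\mathbb{X}}\subseteq\mathfrak{F}_{\widetilde R/R}.$$
   Context: Setting. $P=K[X_0,\dots,X_n]$ has the standard grading, $I_{\mathbb{X}}\subseteq P$ is the (saturated) homogeneous vanishing ideal of $\mathbb{X}$, $R=P/I_{\mathbb{X}}$, and $\mathrm{Supp}(\mathbb{X})=\{p_1,\dots,p_s\}$ is the set of closed points. The residue class $x_0$ of $X_0$ in $R$ is a non-zerodivisor. $\mathcal{O}_{\mathbb{X},p_j}$ is the local ring at $p_j$. $\mathbb{X}$ is locally Gorenstein if every $\mathcal{O}_{\mathbb{X},p_j}$ is a Gorenstein ring. $Q^h(R)$ is the localization of $R$ at all homogeneous non-zerodivisors; $Q^h(R)=R_{x_0}\cong\prod_{j=1}^s\mathcal{O}_{\mathbb{X},p_j}[T_j,T_j^{-1}]$ with $\deg T_j=1$, via the injection $\tilde\imath:R\to Q^h(R)$, $\tilde\imath(f)=(f_{p_1}T_1^i,\dots,f_{p_s}T_s^i)$ for $f\in R_i$, where $f_{p_j}$ is the germ of $f$ at $p_j$ (the image of $f/x_0^i$ in $\mathcal{O}_{\mathbb{X},p_j}$). Conductor. $\widetilde R=\prod_{j=1}^s\mathcal{O}_{\mathbb{X},p_j}[T_j]$,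 which contains $R$ via $\tilde\imath$, and $\mathfrak{F}_{\widetilde R/R}=\{f\in\widetilde R\mid f\widetilde R\subseteq R\}$, an ideal of both $R$ and $\widetilde R$. Dedekind different. $L_0=K[x_0,x_0^{-1}]$. A homogeneous trace map of degree zero of $Q^h(R)/L_0$ is a homogeneous element $\sigma$ of degree $0$ of the graded module $\underline{\mathrm{Hom}}_{L_0}(Q^h(R),L_0)$ which is a $Q^h(R)$-basis of it; it exists when $\mathbb{X}$ is locally Gorenstein. The Dedekind complementary module $\mathfrak{C}^\sigma_{\mathbb{X}}\subseteq Q^h(R)$ is the image of the injection $\underline{\mathrm{Hom}}_{K[x_0]}(R,K[x_0])\to\underline{\mathrm{Hom}}_{L_0}(Q^h(R),L_0)=Q^h(R)\sigma\cong Q^h(R)$, $\varphi\mapsto\varphi\otimes\mathrm{id}_{L_0}$ (the last isomorphism sending $g\sigma$ to $g$). The Dedekind different is $\delta^\sigma_{\mathbb{X}}=\{f\in Q^h(R)\mid f\cdot\mathfrak{C}^\sigma_{\mathbb{X}}\subseteq R\}$, a homogeneous ideal of $R$. *)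

(* Defs.v *)
From HB Require Import structures.
From mathcomp Require Import all_boot all_order all_algebra ring_quotient ring.
From mathcomp Require Import mpoly.
From mathcomp Require Import boolp.

Set Implicit Arguments.
Unset Strict Implicit.
Unset Printing Implicit Defensive.

Import GRing.Theory.
Local Open Scope ring_scope.
Local Open Scope quotient_scope.

Section Localization.

Variables (A : comNzRingType) (S : mulrClosed A).

Definition denom := {s : A | s \in S}.

Definition denom1 : denom := exist _ 1 (rpred1 S).

Definition denomM (s t : denom) : denom :=
  exist _ (sval s * sval t) (rpredM (valP s) (valP t)).

Definition loc_eq (x y : A * denom) : bool :=
  `[< exists2 u, u \in S & u * (x.1 * sval y.2 - y.1 * sval x.2) = 0 >].

Lemma loc_eq_equiv : equiv_class_of loc_eq.
Proof.
split=> [x|x y|y x z].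
- by apply/asboolP; exists 1; rewrite ?rpred1 // subrr mulr0.
- by apply/asboolP/asboolP => -[u uS h]; exists u => //;
    rewrite -opprB mulrN h oppr0.
- move=> /asboolP[u uS hu] /asboolP[v vS hv]; apply/asboolP.
  exists (u * v * sval y.2); first by rewrite !rpredM // (valP y.2).
  have -> : u * v * sval y.2 * (x.1 * sval z.2 - z.1 * sval x.2)
    = v * sval z.2 * (u * (x.1 * sval y.2 - y.1 * sval x.2))
      + u * sval x.2 * (v * (y.1 * sval z.2 - z.1 * sval y.2)) by ring.
  by rewrite hu hv !mulr0 addr0.
Qed.

Canonical loc_eq_equivRel := EquivRelPack loc_eq_equiv.

Definition loc := {eq_quot loc_eq}.

HB.instance Definition _ : EqQuotient _ loc_eq loc := EqQuotient.on loc.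
HB.instance Definition _ := Choice.on loc.

Definition pair_add (x y : A * denom) : A * denom :=
  (x.1 * sval y.2 + y.1 * sval x.2, denomM x.2 y.2).
Definition pair_opp (x : A * denom) : A * denom := (- x.1, x.2).
Definition pair_mul (x y : A * denom) : A * denom :=
  (x.1 * y.1, denomM x.2 y.2).

Definition loc_zero : loc := lift_cst loc (0, denom1).
Definition loc_one : loc := lift_cst loc (1, denom1).
Definition loc_add := lift_op2 loc pair_add.
Definition loc_opp := lift_op1 loc pair_opp.
Definition loc_mul := lift_op2 loc pair_mul.

Canonical pi_loc_zero_morph := PiConst loc_zero.
Canonical pi_loc_one_morph := PiConst loc_one.

Lemma loc_repr x : loc_eq (repr (\pi_loc x)) x.
Proof. by rewrite -eqmodE reprK. Qed.

Lemma pi_loc_opp : {morph \pi_loc : x / pair_opp x >-> loc_opp x}.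
Proof.
move=> x; unlock loc_opp; apply/eqP; rewrite eqmodE.
have /asboolP[u uS h] := loc_repr x; apply/asboolP; exists u => //=.
set y := repr _ in h *.
have -> : u * (- x.1 * sval y.2 - - y.1 * sval x.2)
  = u * (y.1 * sval x.2 - x.1 * sval y.2) by ring.
by [].
Qed.
Canonical pi_loc_opp_morph := PiMorph1 pi_loc_opp.

Lemma pi_loc_add : {morph \pi_loc : x y / pair_add x y >-> loc_add x y}.
Proof.
move=> x y; unlock loc_add; apply/eqP; rewrite eqmodE.
have /asboolP[u uS hu] := loc_repr x; have /asboolP[v vS hv] := loc_repr y.
apply/asboolP; exists (u * v); first by rewrite rpredM.
move: (repr _) (repr _) hu hv => y' x' hu hv /=.
have -> : u * v * ((x.1 * sval y.2 + y.1 * sval x.2) * (sval x'.2 * sval y'.2)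
    - (x'.1 * sval y'.2 + y'.1 * sval x'.2) * (sval x.2 * sval y.2))
  = - (v * sval y.2 * sval y'.2 * (u * (x'.1 * sval x.2 - x.1 * sval x'.2)))
    - u * sval x.2 * sval x'.2 * (v * (y'.1 * sval y.2 - y.1 * sval y'.2)) by ring.
by rewrite hu hv !mulr0 subr0 oppr0.
Qed.
Canonical pi_loc_add_morph := PiMorph2 pi_loc_add.

Lemma pi_loc_mul : {morph \pi_loc : x y / pair_mul x y >-> loc_mul x y}.
Proof.
move=> x y; unlock loc_mul; apply/eqP; rewrite eqmodE.
have /asboolP[u uS hu] := loc_repr x; have /asboolP[v vS hv] := loc_repr y.
apply/asboolP; exists (u * v); first by rewrite rpredM.
move: (repr _) (repr _) hu hv => y' x' hu hv /=.
have -> : u * v * (x.1 * y.1 * (sval x'.2 * sval y'.2)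
    - x'.1 * y'.1 * (sval x.2 * sval y.2))
  = - (v * y.1 * sval y'.2 * (u * (x'.1 * sval x.2 - x.1 * sval x'.2)))
    - u * x'.1 * sval x.2 * (v * (y'.1 * sval y.2 - y.1 * sval y'.2)) by ring.
by rewrite hu hv !mulr0 subr0 oppr0.
Qed.
Canonical pi_loc_mul_morph := PiMorph2 pi_loc_mul.

Lemma loc_eqI (x y : A * denom) :
  x.1 * sval y.2 = y.1 * sval x.2 -> \pi_loc x = \pi_loc y.
Proof.
move=> h; apply/eqP; rewrite eqmodE; apply/asboolP.
by exists 1; rewrite ?rpred1 // h subrr mulr0.
Qed.

Lemma loc_addA : associative loc_add.
Proof.
move=> x y z; rewrite -[x]reprK -[y]reprK -[z]reprK !piE.
by apply: loc_eqI => /=; ring.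
Qed.

Lemma loc_addC : commutative loc_add.
Proof.
move=> x y; rewrite -[x]reprK -[y]reprK !piE.
by apply: loc_eqI => /=; ring.
Qed.

Lemma loc_add0 : left_id loc_zero loc_add.
Proof. by move=> x; rewrite -[x]reprK !piE; apply: loc_eqI => /=; ring. Qed.

Lemma loc_addN : left_inverse loc_zero loc_opp loc_add.
Proof. by move=> x; rewrite -[x]reprK !piE; apply: loc_eqI => /=; ring. Qed.

HB.instance Definition _ :=
  GRing.isZmodule.Build loc loc_addA loc_addC loc_add0 loc_addN.

Lemma loc_mulA : associative loc_mul.
Proof.
move=> x y z; rewrite -[x]reprK -[y]reprK -[z]reprK !piE.
by apply: loc_eqI => /=; ring.
Qed.

Lemma loc_mulC : commutative loc_mul.
Proof.
move=> x y; rewrite -[x]reprK -[y]reprK !piE.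
by apply: loc_eqI => /=; ring.
Qed.

Lemma loc_mul1 : left_id loc_one loc_mul.
Proof. by move=> x; rewrite -[x]reprK !piE; apply: loc_eqI => /=; ring. Qed.

Lemma loc_mulDl : left_distributive loc_mul +%R.
Proof.
change (left_distributive loc_mul loc_add).
move=> x y z; rewrite -[x]reprK -[y]reprK -[z]reprK !piE.
by apply: loc_eqI => /=; ring.
Qed.

HB.instance Definition _ :=
  GRing.Zmodule_isComPzRing.Build loc loc_mulA loc_mulC loc_mul1 loc_mulDl.

(* The fraction a / s; it has this meaning only for s \in S, and is a / 1
   otherwise. *)
Definition frac (a s : A) : loc := \pi_loc (a, insubd denom1 s).

Definition to_loc (a : A) : loc := frac a 1.

Lemma val_denom s : s \in S -> sval (insubd denom1 s) = s.
Proof. exact: insubdK. Qed.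

Lemma frac_eq a s b t : s \in S -> t \in S ->
  frac a s = frac b t <-> exists2 u, u \in S & u * (a * t - b * s) = 0.
Proof.
move=> sS tS; split.
  by move/eqP; rewrite eqmodE => /asboolP /=; rewrite !val_denom.
by move=> h; apply/eqP; rewrite eqmodE; apply/asboolP; rewrite /= !val_denom.
Qed.

Lemma fracD a s b t : s \in S -> t \in S ->
  frac a s + frac b t = frac (a * t + b * s) (s * t).
Proof.
move=> sS tS; rewrite -[LHS]/(loc_add (frac a s) (frac b t)).
rewrite /frac !piE; apply: loc_eqI => /=.
by rewrite !val_denom // rpredM.
Qed.

Lemma fracN a s : - frac a s = frac (- a) s.
Proof. by rewrite -[LHS]/(loc_opp (frac a s)) /frac !piE. Qed.

Lemma fracM a s b t : s \in S -> t \in S ->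
  frac a s * frac b t = frac (a * b) (s * t).
Proof.
move=> sS tS; rewrite -[LHS]/(loc_mul (frac a s) (frac b t)).
rewrite /frac !piE; apply: loc_eqI => /=.
by rewrite !val_denom // rpredM.
Qed.

Lemma frac1 : frac 1 1 = 1.
Proof.
rewrite -[RHS]/loc_one /frac !piE; apply: loc_eqI => /=.
by rewrite val_denom ?rpred1.
Qed.

End Localization.

(* Finite injective dimension is the definition of the Gorenstein property for
   a Noetherian local ring A, as are the local rings of X below. *)
Section Gorenstein.

Variable A : pzRingType.

Definition injective_module (E : lmodType A) : Prop :=
  forall (M N : lmodType A) (f : {linear M -> N}) (g : {linear M -> E}),
    injective f -> exists h : {linear N -> E}, forall x, h (f x) = g x.

(* inj_dim_le d M: there is an exact sequence
   0 -> M -> E_0 -> ... -> E_d -> 0 with all E_i injective *)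
Inductive inj_dim_le : nat -> lmodType A -> Prop :=
| inj_dim_le0 (E : lmodType A) : injective_module E -> inj_dim_le 0 E
| inj_dim_leS (d : nat) (M E C : lmodType A)
    (f : {linear M -> E}) (g : {linear E -> C}) :
    injective_module E -> injective f ->
    (forall y, g y = 0 <-> exists x, f x = y) ->
    (forall z, exists y, g y = z) ->
    inj_dim_le d C -> inj_dim_le d.+1 M.

Definition gorenstein : Prop := exists d, inj_dim_le d (A^o : lmodType A).

End Gorenstein.

Section Subschemes.

Variables (K : fieldType) (n : nat).
Local Notation P := {mpoly K[n.+1]}.

Definition homogeneous_ideal (J : {pred P}) : Prop :=
  forall f d, f \in J -> pihomog mdeg d f \in J.

Definition saturated (J : {pred P}) : Prop :=
  forall f, (exists k, forall g, g \is k.-homog -> g * f \in J) -> f \in J.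

(* The points of the subscheme of P^n_K defined by I: the points of Proj (P/I),
   given by their homogeneous prime ideals in P *)
Record point_of (I : {pred P}) := Point {
  pt_ideal :> prime_idealr P;
  pt_on : {subset I <= pt_ideal};
  pt_homogeneous : homogeneous_ideal pt_ideal;
  pt_relevant : exists i, 'X_i \notin pt_ideal
}.

(* A closed subscheme of P^n_K is given by its saturated homogeneous vanishing
   ideal; being proper and saturated, the ideal defines a nonempty subscheme.
   Its dimension is 0 when no point specializes to a different one. *)
Record zerodim_subscheme := ZeroDimSubscheme {
  vanishing_ideal : idealr P;
  vanishing_homogeneous : homogeneous_ideal vanishing_ideal;
  vanishing_saturated : saturated vanishing_ideal;
  zero_dimensional : forall p q : point_of vanishing_ideal,
    {subset p <= q} -> {subset q <= p}
}.

Variable X : zerodim_subscheme.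
Local Notation I := (vanishing_ideal X).

Definition point := point_of I.

Definition coord_ring := {ideal_quot I}.

HB.instance Definition _ := GRing.ComNzRing.on coord_ring.

Local Notation R := coord_ring.

Definition cls (f : P) : R := \pi_({ideal_quot I}) f.

Lemma clsM : {morph cls : f g / f * g}.
Proof. by move=> f g; rewrite /cls rmorphM. Qed.

Lemma cls1 : cls 1 = 1. Proof. by rewrite /cls rmorph1. Qed.

Lemma clsD : {morph cls : f g / f + g}.
Proof. by move=> f g; rewrite /cls rmorphD. Qed.

Lemma clsN : {morph cls : f / - f}.
Proof. by move=> f; rewrite /cls rmorphN. Qed.

Definition x0 : R := cls 'X_ord0.

Definition homogR (d : nat) (f : R) : Prop :=
  exists2 g : P, g \is d.-homog & f = cls g.

Definition gradR (i : int) (f : R) : Prop :=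
  if i is Posz d then homogR d f else f = 0.

(* The homogeneous component of degree d; independent of the representative
   since I is homogeneous. *)
Definition compR (d : nat) (f : R) : R := cls (pihomog mdeg d (repr f)).

Lemma homogRM a b f g : homogR a f -> homogR b g -> homogR (a + b) (f * g).
Proof.
case=> f' hf -> [g' hg ->]; exists (f' * g'); last by rewrite clsM.
exact: dhomogM.
Qed.

Lemma homogRD a f g : homogR a f -> homogR a g -> homogR a (f + g).
Proof.
case=> f' hf -> [g' hg ->]; exists (f' + g'); last by rewrite clsD.
exact: rpredD.
Qed.

Lemma homogRN a f : homogR a f -> homogR a (- f).
Proof.
by case=> f' hf ->; exists (- f'); rewrite ?clsN // rpredN.
Qed.

Lemma homogR1 : homogR 0 1.
Proof. by exists 1; rewrite ?cls1 //; exact: dhomog1. Qed.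

Section GradedLocalization.

Variable S : mulrClosed R.

Definition grad_loc (i : int) (q : loc S) : Prop :=
  exists (a b : nat) (f s : R),
    [/\ homogR a f, homogR b s, s \in S, q = frac S f s & i = a%:Z - b%:Z].

Definition deg0 : {pred loc S} := fun q => `[< grad_loc 0 q >].

Lemma deg0P q : reflect (exists a f s,
  [/\ homogR a f, homogR a s, s \in S & q = frac S f s]) (q \in deg0).
Proof.
apply: (iffP (asboolP _)).
- move=> [a [b [f [s [hf hs sS -> h]]]]]; exists a, f, s; split=> //.
  by move/esym/eqP: h; rewrite subr_eq0 => /eqP[->].
- by move=> [a [f [s [hf hs sS ->]]]]; exists a, a, f, s; rewrite subrr.
Qed.

Lemma deg0_subring : subring_closed deg0.
Proof.
split.
- apply/deg0P; exists 0%N, 1, 1.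
  by rewrite rpred1 frac1; split=> //; exact: homogR1.
- move=> x y /deg0P[a [f [s [hf hs sS ->]]]] /deg0P[b [g [t [hg ht tS ->]]]].
  apply/deg0P; exists (a + b)%N, (f * t - g * s), (s * t).
  rewrite fracN fracD // mulNr rpredM //; split=> //; last exact: homogRM.
  apply: homogRD; first exact: homogRM.
  by apply: homogRN; rewrite addnC; exact: homogRM.
- move=> x y /deg0P[a [f [s [hf hs sS ->]]]] /deg0P[b [g [t [hg ht tS ->]]]].
  apply/deg0P; exists (a + b)%N, (f * g), (s * t).
  by rewrite fracM // rpredM //; split=> //; exact: homogRM.
Qed.

HB.instance Definition _ := GRing.isSubringClosed.Build (loc S) deg0 deg0_subring.

End GradedLocalization.

Definition off (p : point) : {pred R} := fun s =>
  `[< exists d (g : P), [/\ g \is d.-homog, g \notin pt_ideal p & s = cls g] >].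

Lemma off_mulr_closed p : mulr_closed (off p).
Proof.
split.
  apply/asboolP; exists 0%N, 1; split; rewrite ?cls1 ?idealr1 //.
  exact: dhomog1.
move=> x y /asboolP[a [f [hf fp ->]]] /asboolP[b [g [hg gp ->]]].
apply/asboolP; exists (a + b)%N, (f * g); rewrite clsM; split=> //.
  exact: dhomogM.
by rewrite prime_idealrM negb_or fp.
Qed.

HB.instance Definition _ p :=
  GRing.isMulClosed.Build R (off p) (off_mulr_closed p).

Definition local_ring (p : point) := {q : loc (off p) | q \in @deg0 (off p)}.

Section LocalRing.

Variable p : point.

HB.instance Definition _ := [isSub of local_ring p for val].
HB.instance Definition _ := [Choice of local_ring p by <:].
HB.instance Definition _ := GRing.SubChoice_isSubComPzRing.Build
  (loc (off p)) (@deg0 (off p)) (local_ring p) (@deg0_subring (off p)).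

Lemma local_ring_nonzero : (1 : local_ring p) != 0.
Proof.
apply/eqP => /(congr1 val); rewrite rmorph1 rmorph0 => h.
have : frac (off p) 1 1 = frac (off p) 0 1.
  rewrite frac1 h -(subrr (frac (off p) 0 1)) fracN fracD ?rpred1 //.
  by rewrite oppr0 mulr1 addr0 mulr1.
move=> /(frac_eq _ _ (rpred1 _) (rpred1 _))[u /asboolP[d [g [_ gp ->]]]].
rewrite !mulr1 subr0 mulr1 => /eqP.
rewrite -(rmorph0 \pi_({ideal_quot I})) -Quotient.idealrBE subr0 => gI.
by rewrite (pt_on p gI) in gp.
Qed.

HB.instance Definition _ :=
  GRing.PzSemiRing_isNonZero.Build (local_ring p) local_ring_nonzero.

(* f / x0^i for f homogeneous of degree i and p not on X_0 = 0; the default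
   value 0 is then not used. *)
Definition germ (i : nat) (f : R) : local_ring p :=
  insubd 0 (frac (off p) f (x0 ^+ i)).

End LocalRing.

Definition locally_gorenstein : Prop := forall p, gorenstein (local_ring p).

Definition avoids_X0 : Prop := forall p : point, 'X_ord0 \notin pt_ideal p.

(* The product ranges over Supp X: all points of a zero-dimensional subscheme
   are closed, and there are finitely many of them. *)
Definition Rtilde := forall p : point, {poly local_ring p}.

Definition itilde (f : R) : Rtilde := fun p =>
  \poly_(i < msize (repr f)) germ p i (compR i f).

(* Rtilde carries the componentwise operations. *)
Definition conductor (z : Rtilde) : Prop :=
  forall w : Rtilde, exists f : R, forall p, z p * w p = itilde f p.

Definition conductor_square (v : Rtilde) : Prop :=
  exists (m : nat) (z w : 'I_m -> Rtilde),
    (forall k, conductor (z k) /\ conductor (w k)) /\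
    (forall p, v p = \sum_k z k p * w k p).

Definition hnzd : {pred R} := fun s =>
  `[< (exists d, homogR d s) /\ GRing.lreg s >].

Lemma hnzd_mulr_closed : mulr_closed hnzd.
Proof.
split; first by apply/asboolP; split; [exists 0%N; exact: homogR1 | exact: lreg1].
move=> x y /asboolP[[a ha] rx] /asboolP[[b hb] ry]; apply/asboolP; split.
  by exists (a + b)%N; exact: homogRM.
exact: lregM.
Qed.

HB.instance Definition _ := GRing.isMulClosed.Build R hnzd hnzd_mulr_closed.

Definition Qh := loc hnzd.

HB.instance Definition _ := GRing.ComPzRing.on Qh.

Definition toQh (f : R) : Qh := to_loc hnzd f.

Definition gradQ (i : int) (q : Qh) : Prop := @grad_loc hnzd i q.

(* K[x0] as a subring of R, and K[x0, x0^-1] as a subring of Qh, where x0 is a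
   unit because no point lies on X_0 = 0. *)
Definition Kx0 (f : R) : Prop :=
  exists a : {poly K}, f = cls (map_poly (@mpolyC n.+1 K) a).['X_ord0].

Definition L0 (q : Qh) : Prop :=
  exists (f : R) (k : nat), Kx0 f /\ q * toQh (x0 ^+ k) = toQh f.

(* Graded Homs into a graded subring A of a graded ring M: A-linear maps
   M -> A which are finite sums of homogeneous ones. *)
Section GradedHom.

Variables (M : comPzRingType) (gr : int -> M -> Prop) (A : M -> Prop).

Definition hom_into (phi : M -> M) : Prop :=
  (forall u, A (phi u)) /\
  (forall a u v, A a -> phi (a * u + v) = a * phi u + phi v).

Definition hom_degree (d : int) (phi : M -> M) : Prop :=
  forall i u, gr i u -> gr (i + d) (phi u).

Definition graded_hom (phi : M -> M) : Prop :=
  exists (m : nat) (psi : 'I_m -> M -> M) (d : 'I_m -> int),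
    (forall k, hom_into (psi k) /\ hom_degree (d k) (psi k)) /\
    (forall u, phi u = \sum_k psi k u).

End GradedHom.

Definition HomL0 (phi : Qh -> Qh) : Prop := graded_hom gradQ L0 phi.
Definition HomKx0 (phi : R -> R) : Prop := graded_hom gradR Kx0 phi.

(* Qh acts on HomL0 by (g sigma)(q) = sigma (g q). *)
Definition trace_map (sigma : Qh -> Qh) : Prop :=
  [/\ hom_into L0 sigma, hom_degree gradQ 0 sigma &
      forall phi, HomL0 phi -> exists! g : Qh, forall q, phi q = sigma (g * q)].

(* g sigma = phi (x) id, where Qh = R (x)_{K[x0]} L0 *)
Definition complementary_module (sigma : Qh -> Qh) (g : Qh) : Prop :=
  exists2 phi : R -> R, HomKx0 phi &
    forall (f : R) (l : Qh), L0 l ->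
      sigma (g * (toQh f * l)) = toQh (phi f) * l.

Definition dedekind_different (sigma : Qh -> Qh) (q : Qh) : Prop :=
  forall c, complementary_module sigma c -> exists f : R, q * c = toQh f.

End Subschemes.

(* Main.v *)
(* Write Qh = B[x0, 1/x0] with B, its part of degree 0, the product of the local
   rings, so that Rtilde = B[x0]. A trace map sigma of degree 0 is determined by
   a nondegenerate linear form on B; hence sigma (c Rtilde) lies in K[x0] if and
   only if c is in Rtilde. In particular Rtilde is contained in the
   complementary module C, and the different (R : C) is contained in the
   conductor F = (R : Rtilde). Conversely, for g in F and c in C one has
   sigma (g c Rtilde) = sigma (c (g Rtilde)) in K[x0], so that F C is contained
   in Rtilde and F F C is contained in F Rtilde, hence in R.
   The identification Qh = B[x0, 1/x0] is obtained from one principle: a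
   homogeneous ideal containing I and contained in no point contains a power of
   X_0 (Zorn's lemma). *)
From HB Require Import structures.
From mathcomp Require Import all_boot all_order all_algebra ring_quotient ring.
From mathcomp Require Import mpoly.
From mathcomp Require Import boolp.
From mathcomp Require classical_sets.

Require Import Defs.

Set Implicit Arguments.
Unset Strict Implicit.
Unset Printing Implicit Defensive.

Import Order.TTheory GRing.Theory.
Local Open Scope ring_scope.
Local Open Scope quotient_scope.

(** * Ideals and homogeneous components *)

Section PropIdeals.

Variable A : comNzRingType.
Implicit Types (J : A -> Prop) (x y : A).

(** Ideals are Prop-valued because the ideals below are either given by existential conditions or
    produced by Zorn's lemma; [prime_idealr_exists] leads back to the bundled structure. *)
Definition is_ideal J : Prop :=
  [/\ J 0, forall x y, J x -> J y -> J (x + y) & forall a x, J x -> J (a * x)].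

Lemma idealN J x : is_ideal J -> J x -> J (- x).
Proof. by case=> _ _ h /(h (-1)); rewrite mulN1r. Qed.

Lemma ideal_sum J (T : Type) (r : seq T) (P : pred T) (F : T -> A) :
  is_ideal J -> (forall i, P i -> J (F i)) -> J (\sum_(i <- r | P i) F i).
Proof. by case=> J0 JD _ h; elim/big_ind: _. Qed.

Lemma idealr_is_ideal (J : idealr A) : is_ideal (fun x => x \in J).
Proof. by split; [exact: rpred0|exact: rpredD|move=> a x; exact: idealMr]. Qed.

Section Prime.

Variables (J : A -> Prop) (hJ : is_ideal J) (hJ1 : ~ J 1)
  (hJM : forall x y, J (x * y) -> J x \/ J y).

Definition prime_pred of unit : {pred A} := fun x => `[< J x >].

Lemma prime_pred_idealr u : idealr_closed (prime_pred u).
Proof.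
case: hJ => J0 JD JM; split; first exact/asboolP.
  by apply/asboolP.
by move=> a x y /asboolP Jx /asboolP Jy; apply/asboolP/JD => //; apply: JM.
Qed.

Lemma prime_pred_prime u : prime_idealr_closed (prime_pred u).
Proof.
by move=> x y /asboolP/hJM[h|h]; apply/orP; [left|right]; apply/asboolP.
Qed.

Lemma prime_idealr_exists : exists Q : prime_idealr A, forall x, x \in Q <-> J x.
Proof.
pose i1 := isIdealr.Build A (prime_pred tt) (prime_pred_idealr tt).
pose i2 := isPrimeIdealrClosed.Build A (prime_pred tt) (@prime_pred_prime tt).
pose Q : prime_idealr A := HB.pack (prime_pred tt) i1 i2.
by exists Q => x; split=> /asboolP.
Qed.

End Prime.

End PropIdeals.

Section HomogeneousComponents.

Variables (K : fieldType) (n' : nat).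
Local Notation n := n'.+1.
Local Notation P := {mpoly K[n]}.
Implicit Types (f g h : P) (d e : nat).
Local Notation comp := (pihomog (@mdeg n)).

Lemma comp_sum f k : (forall i, (k <= i)%N -> comp i f = 0) ->
  f = \sum_(i < k) comp i f.
Proof.
move=> h; have [le|lt] := leqP (msize f) k; first exact: pihomog_partitionE.
rewrite {1}(pihomog_partitionE (leqnn (msize f))) -(subnK (ltnW lt)) addnC.
rewrite big_split_ord /= [X in _ + X]big1 ?addr0 // => i _.
by rewrite h ?leq_addr.
Qed.

Lemma comp_ge_msize f i : (msize f <= i)%N -> comp i f = 0.
Proof.
move=> le; rewrite pihomogE big_seq_cond big_pred0 // => m.
apply/negbTE/negP => /andP[/msize_mdeg_lt lt /eqP e].
by rewrite e ltnNge le in lt.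
Qed.

Lemma compM e d h f : h \is e.-homog -> comp (e + d) (h * f) = h * comp d f.
Proof.
move=> hh; pose k := maxn d.+1 (msize f).
rewrite {1}(@pihomog_partitionE _ _ (@mdeg n) k f) ?leq_maxr //.
rewrite mulr_sumr linear_sum /=.
have dk : (d < k)%N by rewrite leq_maxl.
rewrite (bigD1 (Ordinal dk)) //= pihomog_dE ?big1 ?addr0 //.
  move=> i ne; apply: (@pihomog_ne0 _ _ _ (e + i)).
    by rewrite eqn_add2l; apply: contra ne => /eqP E; apply/eqP/val_inj.
  exact: dhomogM (pihomogP _ _ _).
exact: dhomogM (pihomogP _ _ _).
Qed.

Lemma compM_lt e b h f : h \is e.-homog -> (b < e)%N -> comp b (h * f) = 0.
Proof.
move=> hh lt.
rewrite {1}(@pihomog_partitionE _ _ (@mdeg n) (msize f) f) //.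
rewrite mulr_sumr linear_sum big1 // => i _.
apply: (@pihomog_ne0 _ _ _ (e + i)); last exact: dhomogM (pihomogP _ _ _).
by rewrite gtn_eqF // (leq_trans lt) // leq_addr.
Qed.

(** A component of f of degree i < a could reach degree a + b only through a component of g of
    degree above b, and there are none. *)
Lemma comp_top a b f g :
    (forall i, (a < i)%N -> comp i f = 0) ->
    (forall i, (b < i)%N -> comp i g = 0) ->
  comp (a + b) (f * g) = comp a f * comp b g.
Proof.
move=> hf hg; rewrite {1}(@comp_sum f a.+1 hf) mulr_suml linear_sum /=.
rewrite big_ord_recr /= compM ?pihomogP // big1 ?add0r // => i _.
have -> : (a + b = i + (a - i + b))%N.
  by rewrite addnA subnKC // ltnW.
rewrite compM ?pihomogP // hg ?mulr0 //.
by rewrite -[X in (X < _)%N]add0n ltn_add2r subn_gt0.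
Qed.

Definition homog_stable (J : P -> Prop) : Prop := forall f d, J f -> J (comp d f).

Lemma homog_stable_sum (J : P -> Prop) f :
  is_ideal J -> (forall d, J (comp d f)) -> J f.
Proof.
move=> hJ h; rewrite (@pihomog_partitionE _ _ (@mdeg n) (msize f) f) //.
exact: ideal_sum.
Qed.

(** Top components decide: if f g is in J, so is the product of the top components, hence one of
    these. Subtracting it from its factor lowers a degree bound. *)
Lemma homog_prime (J : P -> Prop) : is_ideal J -> homog_stable J ->
    (forall d e f g, f \is d.-homog -> g \is e.-homog ->
       J (f * g) -> J f \/ J g) ->
  forall f g, J (f * g) -> J f \/ J g.
Proof.
move=> hJ stJ prJ f g.
have [J0 JD JM] := hJ.
have JB x y : J x -> J y -> J (x - y) by move=> Jx Jy; apply: JD => //; apply: idealN.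
(* Here a and b are strict bounds for the degrees of f and g, and the induction is on a bound s for
   their sum. *)
have main s : forall a b f g, (a + b <= s)%N ->
    (forall i, (a <= i)%N -> comp i f = 0) ->
    (forall i, (b <= i)%N -> comp i g = 0) -> J (f * g) -> J f \/ J g.
  elim: s => [|s IH] [|a] [|b] // {}f {}g; rewrite ?addn0.
  - by move=> _ hf *; left; rewrite (@comp_sum f 0%N hf) big_ord0.
  - by move=> _ hf *; left; rewrite (@comp_sum f 0%N hf) big_ord0.
  - by move=> _ hf *; left; rewrite (@comp_sum f 0%N hf) big_ord0.
  - by move=> _ _ hg *; right; rewrite (@comp_sum g 0%N hg) big_ord0.
  move=> les hf hg Jfg.
  have := stJ _ (a + b)%N Jfg; rewrite comp_top //.
  have low c h i : (forall i, (c.+1 <= i)%N -> comp i h = 0) -> (c <= i)%N ->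
      comp i (h - comp c h) = 0.
    move=> hh; rewrite leq_eqVlt => /orP[/eqP<-|lt]; rewrite linearB /=.
      by rewrite pihomog_id subrr.
    by rewrite hh // (pihomog_ne0 _ (pihomogP _ c h)) ?subr0 // ltn_eqF.
  case/(prJ _ _ _ _ (pihomogP _ _ _) (pihomogP _ _ _)) => [Jf|Jg].
  - have [|||||h] := IH a b.+1 (f - comp a f) g.
    + by rewrite -ltnS -addSn.
    + by move=> i; apply: low.
    + by [].
    + by rewrite mulrBl; apply: JB; rewrite // mulrC; apply: JM.
    + by left; rewrite -(subrK (comp a f) f); apply: JD.
    by right.
  - have [|||||h] := IH a.+1 b f (g - comp b g).
    + by rewrite -ltnS -addnS.
    + by [].
    + by move=> i; apply: low.
    + by rewrite mulrBr; apply: JB; rewrite //; apply: JM.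
    + by left.
    by right; rewrite -(subrK (comp b g) g); apply: JD.
exact: (main _ (msize f) (msize g) f g (leqnn _)
  (@comp_ge_msize f) (@comp_ge_msize g)).
Qed.

(** A homogeneous ideal that is maximal among those containing J and disjoint from the
    multiplicative set M is prime. *)
Lemma homog_prime_avoiding (J M : P -> Prop) : is_ideal J -> homog_stable J ->
    M 1 -> (forall f g, M f -> M g -> M (f * g)) ->
    (forall f, M f -> exists d, f \is d.-homog) ->
    (forall f, M f -> ~ J f) ->
  exists Q : prime_idealr P,
    [/\ homogeneous_ideal Q, forall f, J f -> f \in Q & forall f, M f -> f \notin Q].
Proof.
move=> hJ stJ M1 MM Mh MJ.
pose good A := [/\ is_ideal A, homog_stable A, forall f, J f -> A f &
  forall f, M f -> ~ A f].
(* Zorn's lemma also asks about the empty chain, whose union is empty and not an ideal; so only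
   nonempty sets are required to be good. *)
have [F Fgood Ftot|Q [Qgood Qmax]] :=
    @classical_sets.Zorn_bigcup P (fun A => forall x, A x -> good A).
  move=> x [X FX Xx].
  have gX Y y : F Y -> Y y -> good Y by move=> FY; apply: Fgood.
  split.
  - split; first by exists X => //; have [[]] := gX _ _ FX Xx.
    + move=> y z [Y FY Yy] [Z FZ Zz].
      have [[_ YD _] _ _ _] := gX _ _ FY Yy.
      have [[_ ZD _] _ _ _] := gX _ _ FZ Zz.
      have [YZ|ZY] := Ftot _ _ FY FZ.
        by exists Z => //; apply: ZD => //; apply: YZ.
      by exists Y => //; apply: YD => //; apply: ZY.
    + move=> c y [Y FY Yy]; exists Y => //.
      by have [[_ _ YM] _ _ _] := gX _ _ FY Yy; apply: YM.
  - move=> f d [Y FY Yf]; exists Y => //.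
    by have [_ st _ _] := gX _ _ FY Yf; apply: st.
  - by move=> f Jf; exists X => //; have [_ _ h _] := gX _ _ FX Xx; apply: h.
  - by move=> f Mf [Y FY Yf]; have [_ _ _ h] := gX _ _ FY Yf; apply: (h f).
(* The maximal set is not empty, since otherwise J would be strictly larger. *)
have {}Qgood : good Q.
  have [[x Qx]|nQ] := pselect (exists x, Q x); first exact: Qgood Qx.
  have := Qmax J; case.
    split; first by move=> x Qx; case: nQ; exists x.
    by move=> JQ; apply: nQ; exists 0; apply: JQ; case: hJ.
  by move=> x _; split.
have [hQ stQ JQ MQ] := Qgood; have [Q0 QD QM] := hQ.
(* By maximality the homogeneous ideal Q + (f) meets M. *)
have ext d f : f \is d.-homog -> ~ Q f -> exists m q c, [/\ M m, Q q & m = q + c * f].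
  move=> hf Qf; apply: contrapT => nM.
  apply: (Qmax (fun x => exists q c, Q q /\ x = q + c * f)).
    split=> [x Qx|le]; first by exists x, 0; rewrite mul0r addr0.
    by apply/Qf/le; exists 0, 1; rewrite mul1r add0r.
  move=> _ _; split.
  - split; first by exists 0, 0; rewrite mul0r addr0.
      move=> _ _ [q [c [Qq ->]]] [q' [c' [Qq' ->]]].
      by exists (q + q'), (c + c'); split; [exact: QD|ring].
    move=> x _ [q [c [Qq ->]]].
    by exists (x * q), (x * c); split; [exact: QM|ring].
  - move=> _ e [q [c [Qq ->]]]; rewrite linearD /=.
    have [le|lt] := leqP d e; last first.
      exists (comp e q), 0; rewrite mulrC (@compM_lt d) // mul0r.
      by split=> //; apply: stQ.
    exists (comp e q), (comp (e - d) c).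
    split; first exact: stQ.
    have := @compM d (e - d) f c hf; rewrite subnKC // => E.
    by rewrite (mulrC c) E mulrC.
  - by move=> x Jx; exists x, 0; rewrite mul0r addr0; split=> //; apply: JQ.
  - by move=> m Mm [q [c [Qq e]]]; apply: nM; exists m, q, c.
have [|Q' Q'E] := @prime_idealr_exists _ Q hQ (MQ _ M1).
  apply: homog_prime => // d e f g hf hg Qfg.
  have [Qf|nQf] := pselect (Q f); first by left.
  have [Qg|nQg] := pselect (Q g); first by right.
  have [m [q [c [Mm Qq mE]]]] := ext _ _ hf nQf.
  have [m' [q' [c' [Mm' Qq' mE']]]] := ext _ _ hg nQg.
  case: (MQ _ (MM _ _ Mm Mm')).
  (* If neither f nor g were in Q, this product of two elements of M would lie in Q. *)
  have -> : m * m' = (q' + c' * g) * q + c * f * q' + c * c' * (f * g).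
    by rewrite mE mE'; ring.
  by apply: (QD); [apply: (QD)|]; apply: (QM).
exists Q'; split=> [f d /Q'E Qf|f /JQ /Q'E //|f Mf].
  by apply/Q'E/stQ.
by apply/negP => /Q'E; apply: MQ.
Qed.

End HomogeneousComponents.

(** * Finite generation of ideals *)

Section Dickson.

(** Each new index is a place where g attains its minimum on the remaining tail. *)
Lemma nondecreasing_subseq (g : nat -> nat) : exists phi : nat -> nat,
  (forall i, (phi i < phi i.+1)%N) /\
  (forall i j, (i <= j)%N -> (g (phi i) <= g (phi j))%N).
Proof.
have min N : exists i, (N <= i)%N /\ forall j, (N <= j)%N -> (g i <= g j)%N.
  have ex : exists v, `[< exists2 i, (N <= i)%N & g i = v >].
    by exists (g N); apply/asboolP; exists N.
  case: (ex_minnP ex) => v /asboolP[i Ni gi] h.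
  exists i; split=> // j Nj; rewrite gi; apply: h.
  by apply/asboolP; exists j.
have [nx nxP] := choice min.
pose phi := fix phi k := if k is k'.+1 then nx (phi k').+1 else nx 0%N.
exists phi; split=> [i|]; first by case: (nxP (phi i).+1).
move=> i j; apply: (@homo_leq _ _ (fun x y => (g x <= g y)%N)) => //.
  by move=> y x z; apply: leq_trans.
case=> [|k] /=; last first.
  case: (nxP (phi k).+1) => le1 h1; case: (nxP (nx (phi k).+1).+1) => le2 h2.
  by apply: h1; apply: leq_trans le1 (ltnW le2).
case: (nxP 0%N) => _ h; exact: h.
Qed.

Lemma mnm_good_pair n (f : nat -> 'X_{1..n}) :
  exists i j, (i < j)%N /\ (f i <= f j)%MM.
Proof.
(* The first k coordinates are nondecreasing along phi; a further subsequence takes care of one more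
   coordinate. *)
have sub k : (k <= n)%N -> exists phi : nat -> nat,
    (forall i, (phi i < phi i.+1)%N) /\ forall c : 'I_n, (c < k)%N ->
      forall i j, (i <= j)%N -> (f (phi i) c <= f (phi j) c)%N.
  elim: k => [|k IH] kn; first by exists id.
  have [phi [incr hphi]] := IH (ltnW kn).
  have [psi [incr' hpsi]] := nondecreasing_subseq (fun i => f (phi i) (Ordinal kn)).
  have mono (chi : nat -> nat) : (forall i, (chi i < chi i.+1)%N) ->
      forall i j, (i <= j)%N -> (chi i <= chi j)%N.
    move=> h i j; apply: (@homo_leq _ _ leq) => //.
      by move=> y x z; apply: leq_trans.
    by move=> k'; apply: ltnW.
  exists (phi \o psi); split=> [i|c] /=.
    exact: leq_trans (incr _) (mono _ incr _ _ (incr' i)).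
  rewrite ltnS leq_eqVlt => /orP[/eqP ck|ck] i j ij.
    by rewrite (_ : c = Ordinal kn) ?hpsi //; apply: val_inj.
  by apply: hphi => //; apply: mono.
have [phi [incr h]] := sub n (leqnn n).
exists (phi 0%N), (phi 1%N); split=> //; apply/mnm_lepP => c; exact: h.
Qed.

(** Otherwise one can choose forever an element of S that no earlier choice divides, contradicting
    [mnm_good_pair]. *)
Lemma dickson n (S : 'X_{1..n} -> Prop) : exists s : seq 'X_{1..n},
  (forall m, m \in s -> S m) /\
  forall m, S m -> exists2 m', m' \in s & (m' <= m)%MM.
Proof.
apply: contrapT => nS.
have next (s : seq 'X_{1..n}) : exists m, (forall x, x \in s -> S x) ->
    S m /\ forall m', m' \in s -> ~~ (m' <= m)%MM.
  have [sS|?] := pselect (forall x, x \in s -> S x); last by exists 0%MM.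
  apply: contrapT => nm; apply: nS; exists s; split=> // m Sm.
  apply: contrapT => h; apply: nm; exists m => _; split=> // m' m's.
  by apply/negP => le; apply: h; exists m'.
have [nx nxP] := choice next.
(* [l k] lists the first k choices, the latest one first. *)
pose l := fix l k := if k is k'.+1 then nx (l k') :: l k' else [::].
have lS k : forall x, x \in l k -> S x.
  elim: k => [|k IH] x //=; rewrite in_cons => /orP[/eqP->|/IH//].
  by case: (nxP _ IH).
have mem i j : (i < j)%N -> nx (l i) \in l j.
  elim: j => // j IH; rewrite ltnS leq_eqVlt /= => /orP[/eqP->|/IH h].
    exact: mem_head.
  by rewrite in_cons h orbT.
have [i [j [ij le]]] := mnm_good_pair (nx \o l).
have [_ /(_ _ (mem _ _ ij))] := nxP _ (lS j).
by rewrite le.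
Qed.

End Dickson.

(** The generators realize a Dickson basis of the leading monomials of J, and division lowers the
    leading monomial. Generation is expressed by containment in every ideal J' that contains s,
    which avoids explicit linear combinations. *)
Lemma hilbert_basis (K : fieldType) (n : nat) (J : {mpoly K[n]} -> Prop) :
  is_ideal J -> exists s : seq {mpoly K[n]}, (forall g, g \in s -> J g) /\
    forall J' : {mpoly K[n]} -> Prop, is_ideal J' ->
      (forall g, g \in s -> J' g) -> forall f, J f -> J' f.
Proof.
move=> hJ; have [J0 JD JM] := hJ.
have [s [sJ scov]] := dickson (fun m => exists f, [/\ J f, f != 0 & mlead f = m]).
have gen m : exists g, m \in s -> [/\ J g, g != 0 & mlead g = m].
  have [ms|_] := boolP (m \in s); last by exists 0.
  by have [g ?] := sJ _ ms; exists g.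
have [G GP] := choice gen.
exists [seq G m | m <- s]; split=> [_ /mapP[m ms ->]|J' [J'0 J'D J'M] sJ' f].
  by case: (GP _ ms).
elim/mleadrect: f => f IH Jf.
have [->//|f0] := eqVneq f 0.
have [m ms le] : exists2 m, m \in s & (m <= mlead f)%MM.
  by apply: scov; exists f.
have [JG G0 leadG] := GP _ ms.
(* The multiple x * G m has the same leading term as f. *)
set c := mleadc f / mleadc (G m); set x := c *: 'X_[mlead f - m].
have J'x : J' (x * G m) by apply: J'M; apply: sJ'; apply: map_f.
have Jx : J (x * G m) by apply: JM.
have cG : mleadc (G m) != 0 by rewrite mleadc_eq0.
have c0 : c != 0 by rewrite mulf_neq0 ?invr_eq0 // mleadc_eq0.
have leadx : mlead x = (mlead f - m)%MM by rewrite mleadZ // mleadXm.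
have x0 : x != 0.
  rewrite mscalerI negb_or c0 /=; apply/eqP => /(congr1 (mcoeff (mlead f - m))).
  by rewrite mcoeffX eqxx mcoeff0 => /eqP; rewrite oner_eq0.
have leadxG : mlead (x * G m) = mlead f by rewrite mleadM // leadx leadG submK.
have cxG : (x * G m)@_(mlead f) = mleadc f.
  rewrite -{1}leadxG mleadM // mleadcM {1}leadx mcoeffZ mcoeffX eqxx mulr1.
  by rewrite divfK.
have {}IH : J' (f - x * G m).
  have [->//|nz] := eqVneq (f - x * G m) 0.
  apply: IH; last by apply: JD => //; apply: idealN.
  rewrite lt_neqAle; apply/andP; split.
    apply: contra nz => /eqP e; rewrite -mleadc_eq0 e mcoeffB cxG subrr //.
  by apply: le_trans (mleadB_le _ _) _; rewrite leadxG leUx lexx.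
by rewrite -(subrK (x * G m) f); apply: J'D.
Qed.

(** * Points *)

Section Points.

Variables (K : fieldType) (n : nat) (X : zerodim_subscheme K n).
Local Notation P := {mpoly K[n.+1]}.
Local Notation I := (vanishing_ideal X).
Local Notation comp := (pihomog (@mdeg n.+1)).
Implicit Types (f g : P) (p q : point X).

Lemma dhomog_var i : ('X_i : P) \is 1.-homog.
Proof. by rewrite dhomogX; apply/eqP; exact: mdeg1. Qed.

(** Once the underlying predicates are identified, all remaining fields are propositions. *)
Lemma point_ext p q : (forall f, f \in pt_ideal p <-> f \in pt_ideal q) -> p = q.
Proof.
case: p q => [[S [[S1] [S2] [S3] [S4]]] p1 p2 p3] [[T [[T1] [T2] [T3] [T4]]] q1 q2 q3] h.
have ST : S = T.
  apply/funext => f; apply/idP/idP => hf; first exact: ((h f).1 hf).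
  exact: ((h f).2 hf).
case: T / ST T1 T2 T3 T4 q1 q2 q3 {h} => T1 T2 T3 T4.
rewrite -(Prop_irrelevance S1 T1) -(Prop_irrelevance S2 T2).
rewrite -(Prop_irrelevance S3 T3) -(Prop_irrelevance S4 T4) => q1 q2 q3.
by congr Point; exact: Prop_irrelevance.
Qed.

Lemma point_sub_eq p q : {subset pt_ideal p <= pt_ideal q} -> p = q.
Proof. by move=> h; apply: point_ext => f; split; [|exact: zero_dimensional]; exact: h. Qed.

Lemma homog_in (J : {pred P}) f : is_ideal (fun x => x \in J) ->
  (forall d, comp d f \in J) -> f \in J.
Proof. by move=> hJ h; exact: (homog_stable_sum hJ h). Qed.

(** The last hypothesis keeps the prime obtained from Zorn's lemma from containing all variables, so
    that it is a point of Proj. *)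
Lemma point_avoiding (J M : P -> Prop) : is_ideal J -> homog_stable J ->
    {in I, forall f, J f} -> M 1 -> (forall f g, M f -> M g -> M (f * g)) ->
    (forall f, M f -> exists d, f \is d.-homog) -> (forall f, M f -> ~ J f) ->
    (forall Q : prime_idealr P, homogeneous_ideal Q ->
       (forall f, M f -> f \notin Q) -> exists i, 'X_i \notin Q) ->
  exists p, (forall f, J f -> f \in pt_ideal p) /\ forall f, M f -> f \notin pt_ideal p.
Proof.
move=> hJ stJ IJ M1 MM Mh MJ rel.
have [Q [hQ JQ MQ]] := homog_prime_avoiding hJ stJ M1 MM Mh MJ.
have IQ : {subset I <= Q} by move=> f /IJ /JQ.
by exists (Point IQ hQ (rel Q hQ MQ)).
Qed.

Lemma point_avoiding_pow (J : P -> Prop) i : is_ideal J -> homog_stable J ->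
    {in I, forall f, J f} -> (forall k, ~ J ('X_i ^+ k)) ->
  exists p, (forall f, J f -> f \in pt_ideal p) /\ 'X_i \notin pt_ideal p.
Proof.
move=> hJ stJ IJ nJ.
pose M f := exists k, f = 'X_i ^+ k.
have [|||||p [Jp Mp]] := @point_avoiding J M hJ stJ IJ.
- by exists 0%N.
- by move=> _ _ [a ->] [b ->]; exists (a + b)%N; rewrite exprD.
- move=> _ [k ->]; exists (1 * k)%N; apply: dhomogMn.
  exact: dhomog_var.
- by move=> _ [k ->]; apply: nJ.
- by move=> Q _ MQ; exists i; apply: MQ; exists 1%N; rewrite expr1.
by exists p; split=> //; apply: Mp; exists 1%N; rewrite expr1.
Qed.

Hypothesis hX0 : avoids_X0 X.

(** A local-to-global device: J is typically the set of all g for which a problem becomes solvable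
    after multiplication by g. Solutions near each point then give one up to a power of X_0. *)
Lemma X0_pow_in (J : P -> Prop) : is_ideal J -> homog_stable J ->
    {in I, forall f, J f} -> (forall p, exists2 f, J f & f \notin pt_ideal p) ->
  exists N, J ('X_ord0 ^+ N).
Proof.
move=> hJ stJ IJ off; apply: contrapT => nJ.
have [|p [Jp _]] := @point_avoiding_pow J ord0 hJ stJ IJ.
  by move=> k Jk; apply: nJ; exists k.
by have [f /Jp ->] := off p.
Qed.

Let I_ideal : is_ideal (fun f => f \in I) := idealr_is_ideal I.

Lemma colon_ideal f : is_ideal (fun g => g * f \in I).
Proof.
split=> [|x y hx hy|a x hx]; first by rewrite mul0r rpred0.
  by rewrite mulrDl rpredD.
by rewrite -mulrA idealMr.
Qed.

Lemma colon_homog d f : f \is d.-homog -> homog_stable (fun g => g * f \in I).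
Proof.
move=> hf g e hg; rewrite mulrC -(compM _ _ hf) mulrC.
exact: vanishing_homogeneous.
Qed.

Lemma irrelevant_pow (J : P -> Prop) : is_ideal J ->
    (forall i, exists k, J ('X_i ^+ k)) ->
  exists N, forall g, g \is N.-homog -> J g.
Proof.
move=> hJ /choice[k kP]; exists (\sum_i k i)%N => g hg.
rewrite [g]mpolyE big_seq; apply: ideal_sum => // m mg.
(* Pigeonhole: the degree of m is the sum of all k i, so not every exponent can be smaller than its
   k i. *)
have [i le] : exists i, (k i <= m i)%N.
  apply: contrapT => h; have e : mdeg m = _ := dhomog_mf hg mg.
  rewrite mdegE in e.
  have lt i : (m i < k i)%N by rewrite ltnNge; apply/negP => le; apply: h; exists i.
  suff : (\sum_i m i < \sum_i k i)%N by rewrite e ltnn.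
  rewrite (bigD1 ord0) // [X in (_ < X)%N](bigD1 ord0) //= -addSn.
  by apply: leq_add => //; apply: leq_sum => i _; apply: ltnW.
have -> : m = (m - U_(i) *+ k i + U_(i) *+ k i)%MM.
  rewrite submK //; apply/mnm_lepP => j; rewrite mulmnE mnm1E.
  by case: eqP => [<-|_]; rewrite ?mul1n.
case: hJ => _ _ JM.
by rewrite mpolyXD -mpolyXn scalerAl; apply: JM.
Qed.

(** For homogeneous f outside I, saturation yields a variable with no power in (I : f), hence a
    point containing (I : f). That point would contain X_0. *)
Lemma X0_regular f : 'X_ord0 * f \in I -> f \in I.
Proof.
move=> hf; apply: homog_in => // d.
have {}hf : 'X_ord0 * comp d f \in I.
  rewrite -(@compM _ _ 1) ?dhomog_var //; exact: vanishing_homogeneous.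
move: (comp d f) (pihomogP (@mdeg n.+1) d f) hf => {}f hf X0f.
apply: contrapT => fI.
have [i iP] : exists i, forall k, ~ ('X_i ^+ k * f \in I).
  apply: contrapT => h; apply: fI; apply: vanishing_saturated.
  apply: (irrelevant_pow (colon_ideal f)) => i.
  apply: contrapT => h'; apply: h; exists i => k hk; apply: h'; by exists k.
have [|p [Jp _]] := @point_avoiding_pow _ i (colon_ideal f) (colon_homog hf) _ iP.
  by move=> g gI; rewrite mulrC idealMr.
by have := hX0 p; rewrite Jp.
Qed.

(** * Local structure at a point and gluing of local data *)

Definition homog_off p f := (exists d, f \is d.-homog) /\ f \notin pt_ideal p.

Lemma homog_off1 p : homog_off p 1.
Proof. by split; [exists 0%N; exact: dhomog1|rewrite idealr1]. Qed.

Lemma homog_offM p f g : homog_off p f -> homog_off p g -> homog_off p (f * g).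
Proof.
move=> [[d hf] fp] [[e hg] gp]; split; first by exists (d + e)%N; exact: dhomogM.
by rewrite prime_idealrM negb_or fp.
Qed.

(** The radical of the ideal quotient (I : u). *)
Definition colon_rad u t := exists N, u * t ^+ N \in I.

Lemma colon_rad_ideal u : is_ideal (colon_rad u).
Proof.
split=> [|x y [a ha] [b hb]|c x [N hN]].
- by exists 1%N; rewrite expr1 mulr0 rpred0.
- exists (a + b)%N; rewrite exprDn mulr_sumr rpred_sum // => i _.
  rewrite mulrnAr; apply: rpredMn.
  have [le|lt] := leqP b i.
    have -> : y ^+ i = y ^+ (i - b) * y ^+ b by rewrite -exprD subnK.
    by rewrite mulrCA (mulrCA u); do 2 apply: idealMr.
  have le : (a <= a + b - i)%N by rewrite -addnBA ?leq_addr // ltnW.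
  have -> : x ^+ (a + b - i) = x ^+ (a + b - i - a) * x ^+ a.
    by rewrite -exprD subnK.
  rewrite -(mulrA (x ^+ _)) mulrCA (mulrC (x ^+ a)) (mulrCA u).
  by do 2 apply: idealMr.
- by exists N; rewrite exprMn mulrCA idealMr.
Qed.

Lemma colon_radM u v t : colon_rad u t -> colon_rad (v * u) t.
Proof. by case=> N h; exists N; rewrite -mulrA idealMr. Qed.

(** If no product u s^N were in I, some point q would avoid all of them. Then q is contained in p,
    so dimension zero gives p contained in q, although s is in p and not in q. *)
Lemma homog_locally_nilpotent p d s : s \is d.-homog -> s \in pt_ideal p ->
  exists2 u, homog_off p u & colon_rad u s.
Proof.
move=> hs sp; apply: contrapT => h.
pose M f := exists u N, homog_off p u /\ f = u * s ^+ N.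
have [|||||q [_ Mq]] := @point_avoiding (fun f => f \in I) M I_ideal
    (@vanishing_homogeneous _ _ X) (fun f fI => fI).
- by exists 1, 0%N; rewrite mul1r; split=> //; exact: homog_off1.
- move=> _ _ [u [a [hu ->]]] [v [b [hv ->]]]; exists (u * v), (a + b)%N.
  by split; [exact: homog_offM|rewrite exprD; ring].
- move=> _ [u [N [[[e hu] _] ->]]]; exists (e + d * N)%N.
  by apply: dhomogM => //; apply: dhomogMn.
- by move=> _ [u [N [hu ->]]] uI; apply: h; exists u => //; exists N.
- move=> Q hQ MQ; have [i ip] := pt_relevant p; exists i; apply: MQ.
  exists 'X_i, 0%N; rewrite mulr1; split=> //; split=> //.
  by exists 1%N; exact: dhomog_var.
(* An element outside p has a homogeneous component outside p; this component belongs to M, so it is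
   not in q. *)
have sub : {subset pt_ideal q <= pt_ideal p}.
  move=> f fq; apply: homog_in => [|e]; first exact: idealr_is_ideal.
  apply: contraT => fp; have := pt_homogeneous e fq.
  rewrite (negPf (Mq _ _)) //; exists (comp e f), 0%N; rewrite mulr1; split=> //.
  by split=> //; exists e; exact: pihomogP.
have := zero_dimensional sub sp; rewrite (negPf (Mq _ _)) //.
by exists 1, 1%N; rewrite mul1r expr1; split=> //; exact: homog_off1.
Qed.

(** The ideal of p is finitely generated, so the product of the multipliers of finitely many
    generators serves for all its elements. *)
Lemma locally_nilpotent p :
  exists2 u, homog_off p u & forall t, t \in pt_ideal p -> colon_rad u t.
Proof.
pose R t := exists2 u, homog_off p u & colon_rad u t.
have hR : is_ideal R.
  split.
  - by exists 1; [exact: homog_off1|exists 1%N; rewrite expr1 mulr0 rpred0].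
  - move=> x y [u hu ux] [v hv vy]; exists (u * v); first exact: homog_offM.
    have [_ h _] := colon_rad_ideal (u * v); apply: h; last exact: colon_radM.
    by rewrite mulrC; apply: colon_radM.
  - move=> a x [u hu ux]; exists u => //.
    by have [_ _ h] := colon_rad_ideal u; apply: h.
have pR t : t \in pt_ideal p -> R t.
  move=> tp; apply: homog_stable_sum => // d.
  exact: homog_locally_nilpotent (pihomogP _ _ _) (pt_homogeneous d tp).
have [s [sp gen]] := hilbert_basis (idealr_is_ideal (pt_ideal p)).
have {sp} [u hu us] : exists2 u, homog_off p u & forall t, t \in s -> colon_rad u t.
  elim: s {gen} sp => [|t s IH] sp; first by exists 1 => //; exact: homog_off1.
  have [|u hu us] := IH; first by move=> g gs; apply: sp; rewrite in_cons gs orbT.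
  have [v hv vt] := pR t (sp _ (mem_head _ _)).
  exists (u * v) => [|g]; first exact: homog_offM.
  rewrite in_cons => /orP[/eqP->|/us ug]; first exact: colon_radM.
  by rewrite mulrC; apply: colon_radM.
by exists u => // t tp; apply: gen => //; exact: colon_rad_ideal.
Qed.

(* The germ of u vanishes at all points other than p and is a unit at p. *)
Lemma separating p : exists2 u, homog_off p u &
  forall q, q <> p -> exists2 v, homog_off q v & v * u \in I.
Proof.
have [u hu up] := locally_nilpotent p; exists u => // q qp.
have [s sp sq] : exists2 s, s \in pt_ideal p & s \notin pt_ideal q.
  apply: contrapT => h; apply: qp; apply/esym/point_sub_eq => f fp.
  by apply: contrapT => /negP fq; apply: h; exists f.
have [d dq] : exists d, comp d s \notin pt_ideal q.
  apply: contrapT => h; move/negP: sq; apply; apply: homog_in => [|d].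
    exact: idealr_is_ideal.
  by apply: contrapT => /negP hd; apply: h; exists d.
have [N hN] := up _ (pt_homogeneous d sp).
(* The component of s lies in p but not in q: some power of it is killed by u, while every power
   stays outside q. *)
exists (comp d s ^+ N); last by rewrite mulrC.
elim: N {hN} => [|N IH]; first exact: homog_off1.
by rewrite exprS; apply: homog_offM => //; split=> //; exists d; exact: pihomogP.
Qed.

(** Quasi-compactness: some power of X_0 lies in every point that contains finitely many chosen
    separating elements. A point outside the chosen list contains them all, hence would contain
    X_0. *)
Lemma finitely_many_points :
  exists (m : nat) (pt : 'I_m -> point X), forall q, exists k, q = pt k.
Proof.
have /choice[u uP] : forall p, exists u : P, homog_off p u /\
    forall q, q <> p -> exists2 v, homog_off q v & v * u \in I.
  by move=> p; have [u h1 h2] := separating p; exists u.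
pose J f := exists m (pt : 'I_m -> point X), forall q,
  (forall k, u (pt k) \in pt_ideal q) -> f \in pt_ideal q.
have [|||p|N [m [pt ptP]]] := @X0_pow_in J.
- split.
  + by exists 0%N, (fun k : 'I_0 => False_rect _ (notF (ltn_ord k))) => q _; exact: rpred0.
  + move=> x y [a [pa ha]] [b [pb hb]].
    exists (a + b)%N, (fun k => match split k with inl i => pa i | inr j => pb j end).
    move=> q h; apply: rpredD; [apply: ha => k|apply: hb => k].
      by have := h (unsplit (inl k)); rewrite unsplitK.
    by have := h (unsplit (inr k)); rewrite unsplitK.
  + by move=> c x [a [pa ha]]; exists a, pa => q /ha; exact: idealMr.
- by move=> f d [a [pa ha]]; exists a, pa => q /ha; exact: pt_homogeneous.
- move=> f fI; exists 0%N, (fun k : 'I_0 => False_rect _ (notF (ltn_ord k))) => q _.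
  exact: pt_on.
- exists (u p); last by case: (uP p) => -[].
  by exists 1%N, (fun=> p) => q; apply; exact: ord0.
exists m, pt => q.
apply: contrapT => h; have := ptP q; rewrite (_ : _ \in _ = false).
  move=> F; suff : false by []; apply: F => k.
  have [_ sep] := uP (pt k).
  have [|v [_ vq] vI] := sep q; first by move=> e; apply: h; exists k.
  by have := pt_on q vI; rewrite prime_idealrM (negPf vq).
apply/negP; elim: N {ptP} => [|N IH]; first by rewrite expr0 idealr1.
by rewrite exprS prime_idealrM (negPf (hX0 q)).
Qed.

(** A regular s lies in no point p: from u s^N in I with u outside p one could cancel s^N and find u
    in I. Thus I + (s) contains a power of X_0. *)
Lemma homog_regular_unit d s : s \is d.-homog ->
    (forall f, s * f \in I -> f \in I) ->
  exists N t, 'X_ord0 ^+ N - s * t \in I.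
Proof.
move=> hs reg; pose J f := exists t, f - s * t \in I.
apply: (@X0_pow_in J).
- split; first by exists 0; rewrite mulr0 subr0 rpred0.
    move=> x y [t ht] [t' ht']; exists (t + t').
    by rewrite mulrDr opprD addrACA rpredD.
  by move=> a x [t ht]; exists (a * t); rewrite mulrCA -mulrBr idealMr.
- move=> f e [t ht]; have := vanishing_homogeneous e ht; rewrite linearB /=.
  have [le|lt] := leqP d e.
    by rewrite -{2}(subnKC le) compM //; exists (comp (e - d) t).
  by rewrite (compM_lt _ hs lt) subr0; exists 0; rewrite mulr0 subr0.
- by move=> f fI; exists 0; rewrite mulr0 subr0.
move=> p; exists s; first by exists 1; rewrite mulr1 subrr rpred0.
apply/negP => sp; have [u [_ up] [N hN]] := homog_locally_nilpotent hs sp.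
suff /(pt_on p) : u \in I by rewrite (negPf up).
elim: N hN => [|N IH]; first by rewrite mulr1.
by rewrite exprS mulrCA => /reg.
Qed.

(** Gluing of the local fractions f p / s p into a single fraction r / X_0^N. J consists of the g
    for which the germs g f p / s p come from one polynomial r. *)
Lemma local_fractions (a : point X -> nat) (f s : point X -> P) :
    (forall p, f p \is (a p).-homog) -> (forall p, s p \is (a p).-homog) ->
    (forall p, s p \notin pt_ideal p) ->
  exists N r, r \is N.-homog /\ forall p,
    exists2 v, homog_off p v & v * (r * s p - 'X_ord0 ^+ N * f p) \in I.
Proof.
move=> hf hs sp.
pose J g := exists r, forall p, exists2 v, homog_off p v & v * (r * s p - g * f p) \in I.
(* The multipliers v and s p are homogeneous, so r may be replaced by its component of the degree of
   g. This gives stability of J and, at the end, a homogeneous r. *)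
have Jcomp g d : J g -> exists2 r, r \is d.-homog &
    forall p, exists2 v, homog_off p v & v * (r * s p - comp d g * f p) \in I.
  move=> [r rP]; exists (comp d r); first exact: pihomogP.
  move=> p; have [v [[e hv] vp] vI] := rP p; exists v; first by split=> //; exists e.
  have := vanishing_homogeneous (e + (a p + d)) vI.
  by rewrite compM // linearB /= ![_ * s p]mulrC ![_ * f p]mulrC !compM.
have [||||N JN] := @X0_pow_in J.
- split.
  + exists 0 => p; exists 1; first exact: homog_off1.
    by rewrite !mul0r subrr mulr0 rpred0.
  + move=> x y [r rP] [r' rP']; exists (r + r') => p.
    have [v hv vI] := rP p; have [v' hv' vI'] := rP' p.
    exists (v * v'); first exact: homog_offM.
    rewrite (_ : _ * _ = v' * (v * (r * s p - x * f p)) + v * (v' * (r' * s p - y * f p))).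
      by rewrite rpredD // idealMr.
    by ring.
  + move=> c x [r rP]; exists (c * r) => p; have [v hv vI] := rP p.
    exists v => //; have -> : v * (c * r * s p - c * x * f p) = c * (v * (r * s p - x * f p)).
      by ring.
    exact: idealMr.
- by move=> g d /(Jcomp g d)[r _ rP]; exists r.
- move=> g gI; exists 0 => p; exists 1; first exact: homog_off1.
  by rewrite mul0r sub0r mul1r rpredN mulrC idealMr.
- move=> p; have [u hu sep] := separating p.
  exists (u * s p); last by case: hu => _ up; rewrite prime_idealrM negb_or up sp.
  (* With r = u f p and g = u s p the two sides agree at p, and both have zero germ at the other
     points because u does. *)
  exists (u * f p) => q; have [->|/sep[v hv vu]] := pselect (q = p).
    by exists 1; [exact: homog_off1|rewrite mulrAC subrr mulr0 rpred0].
  exists v => //; have -> : v * (u * f p * s q - u * s p * f q) = (f p * s q - s p * f q) * (v * u).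
    by ring.
  exact: idealMr.
have [r hr rP] := Jcomp _ N JN; exists N, r; split=> // p.
have XN : ('X_ord0 : P) ^+ N \is N.-homog.
  by rewrite -[X in X.-homog]mul1n; apply/dhomogMn/dhomog_var.
by have := rP p; rewrite pihomog_dE.
Qed.

End Points.

(** * The coordinate ring and its germs *)

Section CoordinateRing.

Variables (K : fieldType) (n : nat) (X : zerodim_subscheme K n).
Local Notation P := {mpoly K[n.+1]}.
Local Notation I := (vanishing_ideal X).
Local Notation R := (coord_ring X).
Local Notation comp := (pihomog (@mdeg n.+1)).
Local Notation cls := (@cls K n X).
Local Notation x0 := (x0 X).
Implicit Types (f g h : R) (p q : point X) (d e k : nat).

Lemma cls_eq (a b : P) : cls a = cls b <-> a - b \in I.
Proof. by rewrite Quotient.idealrBE; split=> [/eqP|/eqP]. Qed.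

Lemma cls0 : cls 0 = 0. Proof. by rewrite /cls rmorph0. Qed.

Lemma cls_eq0 (a : P) : cls a = 0 <-> a \in I.
Proof. by rewrite -cls0 cls_eq subr0. Qed.

Lemma clsK f : cls (repr f) = f. Proof. exact: reprK. Qed.

Lemma clsX (a : P) k : cls (a ^+ k) = cls a ^+ k.
Proof. by rewrite /cls rmorphXn. Qed.

Lemma compR_cls d (a : P) : compR d (cls a) = cls (comp d a).
Proof.
apply/cls_eq; rewrite -linearB /=; apply: vanishing_homogeneous.
by apply/cls_eq; exact: clsK.
Qed.

Lemma compR_additive d : zmod_morphism (@compR K n X d).
Proof.
move=> f g; rewrite -[f]clsK -[g]clsK -clsN -clsD !compR_cls linearB /=.
by rewrite clsD clsN.
Qed.

HB.instance Definition _ d := GRing.isZmodMorphism.Build _ _ (@compR K n X d) (compR_additive d).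

Lemma compR_homog d f : homogR d (compR d f).
Proof. by exists (comp d (repr f)) => //; exact: pihomogP. Qed.

Lemma compR_id d f : homogR d f -> compR d f = f.
Proof. by case=> a ha ->; rewrite compR_cls pihomog_dE. Qed.

Lemma compR_ne d e f : homogR d f -> d != e -> compR e f = 0.
Proof. by case=> a ha -> ne; rewrite compR_cls (pihomog_ne0 ne ha) cls0. Qed.

Lemma compRM_homog e d h f : homogR e h -> compR (e + d) (h * f) = h * compR d f.
Proof.
by case=> a ha ->; rewrite -[f]clsK -clsM !compR_cls (compM _ _ ha) clsM.
Qed.

Lemma compRM_lt e d h f : homogR e h -> (d < e)%N -> compR d (h * f) = 0.
Proof.
by case=> a ha -> lt; rewrite -[f]clsK -clsM !compR_cls (compM_lt _ ha lt) cls0.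
Qed.

Lemma compR_ge f d : (msize (repr f) <= d)%N -> compR d f = 0.
Proof. by move=> le; rewrite /compR comp_ge_msize ?cls0. Qed.

Lemma compR_sum f k : (msize (repr f) <= k)%N -> f = \sum_(d < k) compR d f.
Proof.
move=> le; rewrite -{1}[f]clsK.
by rewrite {1}(@pihomog_partitionE _ _ (@mdeg n.+1) k (repr f)) // /cls rmorph_sum.
Qed.

Lemma compRM d f g : compR d (f * g) = \sum_(i < d.+1) compR i f * compR (d - i) g.
Proof.
(* D covers all components of f and splits off the indices up to d; the later ones do not contribute
   to degree d. *)
set D := (d.+1 + msize (repr f))%N.
rewrite {1}(@compR_sum f D) ?leq_addl // mulr_suml raddf_sum /= big_split_ord /=.
rewrite [X in _ + X]big1 ?addr0 => [|i _].
  apply: eq_bigr => i _; have le : (i <= d)%N by rewrite -ltnS.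
  by rewrite -{1}(subnKC le) compRM_homog //; exact: compR_homog.
by rewrite (compRM_lt _ (compR_homog _ _)) // ltnS leq_addr.
Qed.

Lemma homogR0 d : homogR d (0 : R).
Proof. by exists 0; rewrite ?cls0 // rpred0. Qed.

Lemma homogR_sum d (T : Type) (r : seq T) (Q : pred T) (F : T -> R) :
  (forall i, Q i -> homogR d (F i)) -> homogR d (\sum_(i <- r | Q i) F i).
Proof.
by move=> h; elim/big_ind: _ => //; [exact: homogR0|exact: homogRD].
Qed.

Lemma x0X k : x0 ^+ k = cls ('X_ord0 ^+ k). Proof. by rewrite clsX. Qed.

Lemma homogR_x0 k : homogR k (x0 ^+ k).
Proof.
exists ('X_ord0 ^+ k); last exact: x0X.
by rewrite -[X in X.-homog]mul1n; apply/dhomogMn/dhomog_var.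
Qed.

(** * Germs and the embedding of R into [Rtilde] *)

Hypothesis hX0 : avoids_X0 X.

Lemma x0_lreg k : GRing.lreg (x0 ^+ k).
Proof.
apply: lregX => f g /eqP; rewrite -subr_eq0 -mulrBr => /eqP e; apply/eqP.
rewrite -subr_eq0; apply/eqP; move: (f - g) e => {f g} f.
rewrite -[f]clsK -clsM => /cls_eq0 h.
by apply/cls_eq0; exact: X0_regular h.
Qed.

Lemma offP p f : reflect (exists2 a : P, homog_off p a & f = cls a) (f \in off p).
Proof.
apply: (iffP (asboolP _)) => [[d [a [ha ap ->]]]|[a [[d ha] ap] ->]].
  by exists a => //; split=> //; exists d.
by exists d, a.
Qed.

Lemma x0_off p k : x0 ^+ k \in off p.
Proof.
apply: rpredX; apply/offP; exists 'X_ord0 => //; split; last exact: hX0.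
by exists 1%N; exact: dhomog_var.
Qed.

Lemma val_germ p d f : homogR d f -> val (germ p d f) = frac (off p) f (x0 ^+ d).
Proof.
move=> hf; rewrite /germ insubdK //; apply/deg0P.
by exists d, f, (x0 ^+ d); split=> //; [exact: homogR_x0|exact: x0_off].
Qed.

Lemma germD p d f g : homogR d f -> homogR d g ->
  germ p d (f + g) = germ p d f + germ p d g.
Proof.
move=> hf hg; apply: val_inj; rewrite rmorphD /= !val_germ //; last exact: homogRD.
rewrite fracD ?x0_off //; apply/frac_eq; rewrite ?rpredM ?x0_off //.
by exists 1; rewrite ?rpred1 //; ring.
Qed.

Lemma germ0 p d : germ p d 0 = 0.
Proof.
have := germD p (homogR0 d) (homogR0 d); rewrite addr0 => /eqP.
by rewrite -{1}[germ p d 0]addr0 (inj_eq (addrI _)) => /eqP.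
Qed.

Lemma germ_sum p d (T : Type) (r : seq T) (F : T -> R) :
  (forall i, homogR d (F i)) ->
  germ p d (\sum_(i <- r) F i) = \sum_(i <- r) germ p d (F i).
Proof.
move=> hF; elim: r => [|x r IH]; first by rewrite !big_nil germ0.
by rewrite !big_cons germD ?IH //; exact: homogR_sum.
Qed.

Lemma germM p d e f g : homogR d f -> homogR e g ->
  germ p (d + e) (f * g) = germ p d f * germ p e g.
Proof.
move=> hf hg; apply: val_inj; rewrite rmorphM /= !val_germ //; last exact: homogRM.
by rewrite fracM ?x0_off // exprD.
Qed.

Lemma germ_x0 p k : germ p k (x0 ^+ k) = 1.
Proof.
apply: val_inj; rewrite rmorph1 /= val_germ; last exact: homogR_x0.
rewrite -frac1; apply/frac_eq; rewrite ?rpred1 ?x0_off //.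
by exists 1; rewrite ?rpred1 //; ring.
Qed.

(** Vanishing germs mean that the annihilator of f is contained in no point; so it contains a power
    of x0, which is regular. *)
Lemma germ_inj d f : homogR d f -> (forall p, germ p d f = 0) -> f = 0.
Proof.
move=> hf0 h; have [a ha fE] := hf0.
have [|p|N] := @X0_pow_in _ _ X _ (colon_ideal X a) (colon_homog ha).
- by move=> b bI; rewrite mulrC idealMr.
- have /(congr1 val) := h p.
  rewrite -(germ0 p 0) !val_germ ?expr0 //; last exact: homogR0.
  case/frac_eq; rewrite ?x0_off ?rpred1 // => u /offP[b [_ bp] ->].
  rewrite mul0r subr0 mulr1 fE -clsM => /cls_eq0 baI; by exists b.
rewrite -cls_eq0 clsM -x0X -fE => e; apply: (@x0_lreg N).
by rewrite e mulr0.
Qed.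

Lemma coef_itilde f p i : (itilde f p)`_i = germ p i (compR i f).
Proof.
rewrite coef_poly; case: ltnP => // le.
by rewrite compR_ge // germ0.
Qed.

Lemma itildeD f g p : itilde (f + g) p = itilde f p + itilde g p.
Proof.
apply/polyP => i; rewrite coefD !coef_itilde raddfD germD //; exact: compR_homog.
Qed.

Lemma itildeM f g p : itilde (f * g) p = itilde f p * itilde g p.
Proof.
apply/polyP => i; rewrite coefM coef_itilde compRM germ_sum => [|j].
  apply: eq_bigr => j _; rewrite !coef_itilde -germM; try exact: compR_homog.
  by rewrite subnKC // -ltnS.
by rewrite -{1}(subnKC (ltn_ord j : (j <= i)%N)); apply: homogRM; exact: compR_homog.
Qed.

Lemma itilde0 p : itilde (0 : R) p = 0.
Proof. by apply/polyP => i; rewrite coef_itilde raddf0 germ0 coef0. Qed.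

Lemma itilde_sum (T : Type) (r : seq T) (F : T -> R) p :
  itilde (\sum_(i <- r) F i) p = \sum_(i <- r) itilde (F i) p.
Proof.
elim: r => [|x r IH]; first by rewrite !big_nil itilde0.
by rewrite !big_cons itildeD IH.
Qed.

Lemma itilde_homog d f p : homogR d f -> itilde f p = (germ p d f)%:P * 'X^d.
Proof.
move=> hf; apply/polyP => i; rewrite coefCM coefXn coef_itilde.
have [->|ne] := eqVneq i d; first by rewrite compR_id // mulr1.
by rewrite (compR_ne hf) 1?eq_sym // germ0 mulr0.
Qed.

Lemma itilde_x0 k p : itilde (x0 ^+ k) p = 'X^k.
Proof. by rewrite (itilde_homog p (homogR_x0 k)) germ_x0 mul1r. Qed.

Lemma itilde_inj f g : (forall p, itilde f p = itilde g p) -> f = g.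
Proof.
move=> h; apply/eqP; rewrite -subr_eq0; apply/eqP.
rewrite (@compR_sum (f - g) _ (leqnn _)) big1 // => i _.
rewrite raddfB /=; apply: (@germ_inj i) => [|p].
  by rewrite -raddfB; exact: compR_homog.
have /(congr1 (fun s : {poly _} => s`_i)) := h p; rewrite !coef_itilde => e.
have hN : homogR i (- compR i g) by apply: homogRN; exact: compR_homog.
rewrite germD // ?e; try exact: compR_homog.
rewrite -germD //; last exact: compR_homog.
by rewrite subrr germ0.
Qed.

(** With [germ_inj], this identifies the part of degree 0 of R[1/x0] with the product of the local
    rings. *)
Lemma germ_surj (b : forall p, local_ring p) :
  exists N f, homogR N f /\ forall p, germ p N f = b p.
Proof.
have /choice[F FP] p : exists t : nat * P * P,
    [/\ t.1.2 \is (t.1.1).-homog, t.2 \is (t.1.1).-homog, t.2 \notin pt_ideal p &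
        val (b p) = frac (off p) (cls t.1.2) (cls t.2)].
  have /deg0P[d [f [s [[a ha fE] [c hc sE] sp bE]]]] := valP (b p).
  exists (d, a, c); split=> //=; last by rewrite bE fE sE.
  (* Membership in [off p] provides some representative c' outside p; c differs from it by an
     element of I and is therefore outside p too. *)
  have /offP[c' [_ c'p]] := sp; rewrite sE => /cls_eq cI.
  apply: contra c'p => cp; rewrite -(subKr c c') rpredB //.
  exact: pt_on cI.
have [||| N [r [hr rP]]] := @local_fractions _ _ _ (fun p => (F p).1.1)
   (fun p => (F p).1.2) (fun p => (F p).2).
- by move=> p; case: (FP p).
- by move=> p; case: (FP p).
- by move=> p; case: (FP p).
have hcr : homogR N (cls r) by exists r.
exists N, (cls r); split=> // p.
have [hf hs sp bE] := FP p.
apply: val_inj; rewrite val_germ // bE; apply/frac_eq; first exact: x0_off.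
  by apply/offP; exists (F p).2 => //; split=> //; exists (F p).1.1.
have [v hv vI] := rP p; exists (cls v); first by apply/offP; exists v.
by rewrite x0X -!clsM -clsN -clsD -clsM (mulrC (F p).1.2); apply/cls_eq0.
Qed.

(** Finiteness of the set of points bounds the sizes of all w p at once, so that only finitely many
    coefficient families must be lifted and a common k exists. *)
Lemma itilde_surj (w : Rtilde X) : exists k f, forall p, itilde f p = 'X^k * w p.
Proof.
have [m [pt ptP]] := finitely_many_points hX0.
pose D := (\max_(k < m) size (w (pt k)))%N.
have wD p : (size (w p) <= D)%N.
  by have [k ->] := ptP p; exact: (@leq_bigmax _ (fun k : 'I_m => size (w (pt k)))).
have /choice[F FP] (j : 'I_D) : exists t : nat * R, homogR t.1 t.2 /\
    forall p, germ p t.1 t.2 = (w p)`_j.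
  by have [N [f hf]] := germ_surj (fun p => (w p)`_j); exists (N, f).
pose N := (\max_(j < D) (F j).1)%N.
(* The powers of x0 raise the lift of the j-th coefficients to degree N + j. *)
exists N, (\sum_(j < D) x0 ^+ (j + (N - (F j).1)) * (F j).2) => p.
have -> : w p = \sum_(j < D) (w p)`_j *: 'X^j.
  rewrite -(poly_def D (fun j => (w p)`_j)); apply/polyP => i; rewrite coef_poly.
  by case: ltnP => // le; rewrite nth_default // (leq_trans (wD p)).
rewrite itilde_sum mulr_sumr; apply: eq_bigr => j _.
have [hj gj] := FP j.
have le : ((F j).1 <= N)%N by exact: (@leq_bigmax _ (fun j : 'I_D => (F j).1)).
rewrite itildeM itilde_x0 (itilde_homog p hj) gj -mul_polyC.
by rewrite mulrCA -exprD -addnA subnK // mulrCA -exprD addnC.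
Qed.

End CoordinateRing.

(** * The homogeneous localization and the trace map *)

Section HomogeneousLocalization.

Variables (K : fieldType) (n : nat) (X : zerodim_subscheme K n).
Local Notation P := {mpoly K[n.+1]}.
Local Notation R := (coord_ring X).
Local Notation Q := (Qh X).
Local Notation S := (@hnzd K n X).
Local Notation x0 := (x0 X).
Local Notation L0 := (@L0 K n X).
Local Notation Kx0 := (@Kx0 K n X).
Implicit Types (f g h : R) (a b c q z : Q) (d e k : nat).

Hypothesis hX0 : avoids_X0 X.

Lemma toQhD f g : toQh (f + g) = toQh f + toQh g.
Proof.
rewrite /toQh /to_loc fracD ?rpred1 //; apply/frac_eq; rewrite ?rpredM ?rpred1 //.
by exists 1; rewrite ?rpred1 //; ring.
Qed.

Lemma toQhM f g : toQh (f * g) = toQh f * toQh g.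
Proof.
rewrite /toQh /to_loc fracM ?rpred1 //; apply/frac_eq; rewrite ?rpredM ?rpred1 //.
by exists 1; rewrite ?rpred1 //; ring.
Qed.

Lemma toQh1 : toQh (1 : R) = 1. Proof. exact: frac1. Qed.

Lemma toQh0 : toQh (0 : R) = 0.
Proof. by have /eqP := toQhD 0 0; rewrite addr0 -subr_eq subrr => /eqP. Qed.

Lemma toQh_sum (T : Type) (r : seq T) (F : T -> R) :
  toQh (\sum_(i <- r) F i) = \sum_(i <- r) toQh (F i).
Proof.
elim: r => [|x r IH]; first by rewrite !big_nil toQh0.
by rewrite !big_cons toQhD IH.
Qed.

Lemma hnzd_lreg s : s \in S -> GRing.lreg s.
Proof. by move/asboolP => []. Qed.

Lemma toQh_inj : injective (@toQh K n X).
Proof.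
move=> f g /frac_eq; case; rewrite ?rpred1 // => u /hnzd_lreg reg.
by rewrite !mulr1 mulrBr => /eqP; rewrite subr_eq0 => /eqP /reg.
Qed.

Lemma x0_hnzd k : x0 ^+ k \in S.
Proof.
apply/asboolP; split; last exact: x0_lreg.
by exists k; exact: homogR_x0.
Qed.

Definition x0frac f k : Q := frac S f (x0 ^+ k).

Lemma mul_x0frac f k : toQh (x0 ^+ k) * x0frac f k = toQh f.
Proof.
rewrite /toQh /to_loc /x0frac fracM ?rpred1 ?x0_hnzd //.
apply/frac_eq; rewrite ?rpredM ?rpred1 ?x0_hnzd //.
by exists 1; rewrite ?rpred1 //; ring.
Qed.

Lemma x0_cancel k a b : toQh (x0 ^+ k) * a = toQh (x0 ^+ k) * b -> a = b.
Proof.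
move=> /(congr1 (fun c => x0frac 1 k * c)); rewrite !mulrA (mulrC _ (toQh _)).
by rewrite mul_x0frac toQh1 !mul1r.
Qed.

Lemma x0_cancel0 k a : toQh (x0 ^+ k) * a = 0 -> a = 0.
Proof. by move=> h; apply: (@x0_cancel k); rewrite h mulr0. Qed.

Lemma x0fracP q f k : toQh (x0 ^+ k) * q = toQh f -> q = x0frac f k.
Proof. by move=> h; apply: (@x0_cancel k); rewrite h mul_x0frac. Qed.

Lemma x0frac_sum (T : Type) (r : seq T) (F : T -> R) k :
  x0frac (\sum_(i <- r) F i) k = \sum_(i <- r) x0frac (F i) k.
Proof.
apply: (@x0_cancel k); rewrite mul_x0frac mulr_sumr toQh_sum.
by apply: eq_bigr => i _; rewrite mul_x0frac.
Qed.

(** Every homogeneous non-zerodivisor divides a power of x0, whence [Qh] is the localization at x0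
    alone. *)
Lemma hnzd_dvd_x0 e s : homogR e s -> s \in S ->
  exists N t, homogR N t /\ x0 ^+ (e + N) = s * t.
Proof.
move=> [s' hs' sE] /hnzd_lreg reg.
have [|N [t]] := homog_regular_unit (X := X) hs'.
  move=> a; rewrite -!cls_eq0 clsM -sE => h; apply: reg.
  by rewrite h mulr0.
rewrite -cls_eq0 clsD clsN clsM -x0X -sE => /eqP; rewrite subr_eq0 => /eqP h.
(* The cofactor t need not be homogeneous. Multiplying by x0^e puts the product in degree e + N, and
   the component of degree N is then the homogeneous cofactor. *)
exists N, (compR N (cls X t * x0 ^+ e)); split; first exact: compR_homog.
rewrite -(@compRM_homog _ _ _ e N); last by exists s'.
by rewrite mulrA -h -exprD addnC compR_id //; exact: homogR_x0.
Qed.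

Lemma homog_frac e f s : homogR e s -> s \in S -> exists N t,
  homogR N t /\ toQh (x0 ^+ (e + N)) * frac S f s = toQh (f * t).
Proof.
move=> hs sS; have [N [t [ht h]]] := hnzd_dvd_x0 hs sS; exists N, t; split=> //.
rewrite h /toQh /to_loc fracM ?rpred1 //; apply/frac_eq; rewrite ?rpredM ?rpred1 //.
by exists 1; rewrite ?rpred1 //; ring.
Qed.

Lemma Qh_x0frac q : exists f k, q = x0frac f k.
Proof.
have [[f [s sS]] ->] : exists x, q = \pi_Q x by exists (repr q); rewrite reprK.
have := sS => /asboolP[[e hs] _].
have [N [t [ht h]]] := homog_frac f hs sS.
exists (f * t), (e + N)%N; apply: x0fracP; rewrite -h; congr (_ * _).
by rewrite /frac; congr (\pi_Q (_, _)); apply: val_inj; rewrite /= val_denom.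
Qed.

(* Unifying the two canonical semiring structures on coord_ring takes very long,
   which exact_no_check leaves to the kernel's (fast) conversion. *)
Lemma gradQE i q : gradQ i q <-> exists d e (f s : R),
  [/\ homogR d f, homogR e s, s \in S, q = frac S f s & i = d%:Z - e%:Z].
Proof.
split; intros [d [e [f [s [hf hs sS qE iE]]]]].
  exists d, e, f, s; split; [exact hf|exact hs|exact sS|exact qE|exact iE].
unfold gradQ, grad_loc.
exists d, e, f, s; split; [exact hf|exact hs|exact sS|exact_no_check qE|exact iE].
Qed.

Lemma gradQ_x0frac d f k : homogR d f -> gradQ (d%:Z - k%:Z) (x0frac f k).
Proof.
move=> hf; apply/gradQE; exists d, k, f, (x0 ^+ k).
by split=> //; [exact: homogR_x0|exact: x0_hnzd].
Qed.

Lemma gradQ_toQh d f : homogR d f -> gradQ d%:Z (toQh f).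
Proof.
move=> hf; have := gradQ_x0frac 0 hf; rewrite subr0.
by rewrite -(x0fracP (q := toQh f)) // expr0 toQh1 mul1r.
Qed.

(** All large N are allowed so that finitely many elements can be cleared by one common power of
    x0. *)
Lemma gradQP i q : gradQ i q -> exists M, forall N, (M <= N)%N ->
  exists2 d, d%:Z - N%:Z = i & exists2 f, homogR d f & toQh (x0 ^+ N) * q = toQh f.
Proof.
move=> /gradQE[d [e [f [s [hf hs sS -> ->]]]]].
have [M [t [ht h]]] := homog_frac f hs sS.
exists (e + M)%N => N le; exists (d + M + (N - (e + M)))%N.
  by rewrite -{2}(subnK le) !PoszD; ring.
exists (f * t * x0 ^+ (N - (e + M))).
  by apply: homogRM; [exact: homogRM|exact: homogR_x0].
by rewrite -{1}(subnKC le) exprD toQhM mulrAC h -toQhM.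
Qed.

Lemma L0_toQh f : Kx0 f -> L0 (toQh f).
Proof. by move=> hf; exists f, 0%N; rewrite -toQhM mulr1. Qed.

Lemma Kx0_x0 k : Kx0 (x0 ^+ k).
Proof.
by exists 'X^k; rewrite map_polyXn hornerXn x0X.
Qed.

Lemma L0_1 : L0 1.
Proof. by rewrite -toQh1; apply: L0_toQh; exact: (Kx0_x0 0). Qed.

Lemma gradQM i j a b : gradQ i a -> gradQ j b -> gradQ (i + j) (a * b).
Proof.
move=> /gradQE[d [e [f [s [hf hs sS -> ->]]]]].
move=> /gradQE[d' [e' [f' [s' [hf' hs' sS' -> ->]]]]].
apply/gradQE; exists (d + d')%N, (e + e')%N, (f * f'), (s * s').
split; [exact: homogRM|exact: homogRM|exact: rpredM|exact: fracM|].
by rewrite !PoszD; ring.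
Qed.

Lemma homogR_of_toQh d f : gradQ d%:Z (toQh f) -> homogR d f.
Proof.
move=> /gradQP[M /(_ M (leqnn M))[e eE [g hg]]]; rewrite -toQhM => /toQh_inj h.
have [{eE} e_eq] : e%:Z = (M + d)%N by rewrite PoszD -eE addrC subrK.
suff -> : f = compR d f by exact: compR_homog.
apply: (x0_lreg hX0 (k := M)).
by rewrite -(compRM_homog _ _ (homogR_x0 X M)) h -e_eq compR_id.
Qed.

Lemma Kx0D f g : Kx0 f -> Kx0 g -> Kx0 (f + g).
Proof.
by move=> [a ->] [b ->]; exists (a + b); rewrite rmorphD hornerD clsD.
Qed.

Lemma Kx0_sum (T : Type) (r : seq T) (F : T -> R) :
  (forall i, Kx0 (F i)) -> Kx0 (\sum_(i <- r) F i).
Proof.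
move=> hF; elim/big_ind: _ => //; last exact: Kx0D.
by exists 0; rewrite rmorph0 horner0 cls0.
Qed.

Lemma Kx0_comp f d : Kx0 f -> exists c : K, compR d f = cls X c%:MP * x0 ^+ d.
Proof.
move=> [a ->]; exists a`_d; rewrite compR_cls x0X -clsM; congr (cls X _).
have le : (size (map_poly (@mpolyC n.+1 K) a) <= d.+1 + size a)%N.
  by apply: leq_trans (size_poly _ _) _; rewrite leq_addl.
have hX i : ((@mpolyC n.+1 K) a`_i * 'X_ord0 ^+ i) \is i.-homog.
  rewrite mul_mpolyC; apply: dhomogZ.
  by rewrite -[X in X.-homog]mul1n; apply/dhomogMn/dhomog_var.
rewrite (horner_coef_wide _ le) raddf_sum /=.
have lt : (d < d.+1 + size a)%N by rewrite leq_addr.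
rewrite (bigD1 (Ordinal lt)) //= coef_map (pihomog_dE (hX d)) big1 ?addr0 // => i ne.
rewrite coef_map; apply: pihomog_ne0 (hX i).
by apply: contra ne => /eqP e; apply/eqP/val_inj.
Qed.

Lemma Kx0_monomial (c : K) d : Kx0 (cls X c%:MP * x0 ^+ d).
Proof.
by exists (c%:P * 'X^d); rewrite rmorphM /= map_polyC map_polyXn hornerM hornerC hornerXn x0X clsM.
Qed.

(** If z = f0 / x0^k has degree d, only the component of f0 of degree d + k matters, and this is a
    scalar times a power of x0. Hence [L0] in nonnegative degree is K[x0]. *)
Lemma L0_homog z d : L0 z -> gradQ d%:Z z ->
  exists f, [/\ Kx0 f, homogR d f & z = toQh f].
Proof.
move=> [f0 [k [hf0 zf0]]] hz.
have [M /(_ M (leqnn M))[e eE [g hg Mz]]] := gradQP hz.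
have [{eE} e_eq] : e%:Z = (M + d)%N by rewrite PoszD -eE addrC subrK.
have e1 : x0 ^+ M * f0 = x0 ^+ k * g.
  by apply: toQh_inj; rewrite !toQhM -zf0 -Mz; ring.
have [c cE] := Kx0_comp (d + k) hf0.
have e2 : x0 ^+ M * compR (d + k) f0 = x0 ^+ k * g.
  rewrite -(compRM_homog _ _ (homogR_x0 X M)) e1 compR_id // addnA -e_eq addnC.
  by apply: homogRM => //; exact: homogR_x0.
have zE : z = toQh (cls X c%:MP * x0 ^+ d).
  apply: (@x0_cancel M); apply: (@x0_cancel k).
  rewrite Mz -!toQhM -e2 cE exprD; congr toQh; ring.
exists (cls X c%:MP * x0 ^+ d); split=> //; first exact: Kx0_monomial.
by apply: homogR_of_toQh; rewrite -zE.
Qed.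

(** * The trace map and the complementary module *)

Section Trace.

Variable sigma : Q -> Q.
Hypothesis hsigma : trace_map sigma.

Lemma sigmaD a b : sigma (a + b) = sigma a + sigma b.
Proof.
have [[_ lin] _ _] := hsigma.
by have := lin 1 a b L0_1; rewrite !mul1r.
Qed.

Lemma sigma0 : sigma 0 = 0.
Proof.
by have /eqP := sigmaD 0 0; rewrite addr0 -subr_eq subrr => /eqP.
Qed.

Lemma sigmaZ l a : L0 l -> sigma (l * a) = l * sigma a.
Proof.
have [[_ lin] _ _] := hsigma => hl.
by have := lin l a 0 hl; rewrite sigma0 !addr0.
Qed.

Lemma sigma_sum (T : Type) (r : seq T) (F : T -> Q) :
  sigma (\sum_(i <- r) F i) = \sum_(i <- r) sigma (F i).
Proof.
elim: r => [|x r IH]; first by rewrite !big_nil sigma0.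
by rewrite !big_cons sigmaD IH.
Qed.

Lemma sigma_L0 a : L0 (sigma a).
Proof. by have [[h _] _ _] := hsigma. Qed.

Lemma sigma_grad i a : gradQ i a -> gradQ i (sigma a).
Proof. by have [_ h _] := hsigma => /h; rewrite addr0. Qed.

(** Both a and 0 represent the zero functional, which is a graded map as an empty sum. *)
Lemma sigma_nondegenerate a : (forall q, sigma (a * q) = 0) -> a = 0.
Proof.
move=> h; have [_ _ uniq] := hsigma.
have [|g [_ gU]] := uniq (fun=> 0).
  exists 0%N, (fun k : 'I_0 => id), (fun=> 0); split; first by case.
  by move=> u; rewrite big_ord0.
by rewrite -(gU a) ?(gU 0) // => q; rewrite mul0r sigma0.
Qed.

(** For a of degree e >= 0, the functional a sigma sends R in degree j into [L0] in degree j + e >=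
    0, that is, into K[x0]. *)
Lemma sigma_restrict a e : gradQ e%:Z a -> exists phi : R -> R,
  [/\ hom_into Kx0 phi, hom_degree (@gradR K n X) e phi &
      forall f, toQh (phi f) = sigma (a * toQh f)].
Proof.
move=> ha.
have hgrad j f : homogR j f -> gradQ (j + e)%N%:Z (sigma (a * toQh f)).
  move=> hf; apply: sigma_grad; rewrite PoszD addrC.
  by apply: gradQM => //; exact: gradQ_toQh.
have /choice[phi phiP] f : exists g, Kx0 g /\ toQh g = sigma (a * toQh f).
  have /choice[F FP] (j : nat) :
      exists g, Kx0 g /\ toQh g = sigma (a * toQh (compR j f)).
    have [g [hg _ gE]] := L0_homog (sigma_L0 _) (hgrad j _ (compR_homog j f)).
    by exists g.
  exists (\sum_(j < msize (repr f)) F j); split.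
    by apply: Kx0_sum => j; case: (FP j).
  rewrite toQh_sum [in RHS](compR_sum (leqnn (msize (repr f)))).
  rewrite toQh_sum mulr_sumr sigma_sum.
  by apply: eq_bigr => j _; case: (FP j).
exists phi; split; [split|..].
- by move=> f; case: (phiP f).
- move=> c f g hc; apply: toQh_inj; rewrite toQhD toQhM.
  rewrite !(phiP _).2 toQhD toQhM mulrDr sigmaD mulrCA.
  by rewrite (sigmaZ _ (L0_toQh hc)).
- move=> [j|j] f /= hf.
    by apply: homogR_of_toQh; rewrite (phiP _).2; exact: hgrad.
  have -> : phi f = 0.
    by apply: toQh_inj; rewrite (phiP _).2 hf toQh0 mulr0 sigma0.
  by case: (Negz j + e) => [d|d] //=; exact: homogR0.
- by move=> f; case: (phiP f).
Qed.

Lemma complementary_sum (m : nat) (c : 'I_m -> Q) (e : 'I_m -> nat) :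
    (forall j, gradQ (e j)%:Z (c j)) ->
  complementary_module sigma (\sum_j c j).
Proof.
move=> hc; have /choice[psi psiP] (j : 'I_m) := sigma_restrict (hc j).
exists (fun f => \sum_j psi j f).
  exists m, psi, (fun j => (e j)%:Z); split=> // j.
  by case: (psiP j).
move=> f l hl.
rewrite toQh_sum mulr_suml mulr_suml sigma_sum; apply: eq_bigr => j _.
have [_ _ ->] := psiP j.
by rewrite mulrA mulrC (sigmaZ _ hl) mulrC.
Qed.

Lemma complementary_value c f : complementary_module sigma c ->
  exists g, sigma (c * toQh f) = toQh g.
Proof.
move=> [phi _ h]; exists (phi f).
by have := h f 1 L0_1; rewrite !mulr1.
Qed.

End Trace.

End HomogeneousLocalization.

(** * The conductor *)

Section Conductor.

Variables (K : fieldType) (n : nat) (X : zerodim_subscheme K n).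
Local Notation R := (coord_ring X).
Local Notation Q := (Qh X).
Local Notation x0 := (x0 X).
Implicit Types (f g h r : R) (a b c q : Q) (p : point X) (d k : nat).

Hypothesis hX0 : avoids_X0 X.

(** The vanishing of the components of r below k says that r / x0^k belongs to [Rtilde], where
    [drop_poly k] performs the division by X^k. *)
Lemma conductor_mul_x0frac f r k :
    conductor (itilde f) -> (forall i, (i < k)%N -> compR i r = 0) ->
  exists h, toQh f * x0frac r k = toQh h.
Proof.
move=> cf hr; have [h hE] := cf (fun p => drop_poly k (itilde r p)).
exists h; apply: (x0_cancel hX0 (k := k)).
rewrite mulrCA (mul_x0frac hX0) -!toQhM; congr toQh.
apply: (itilde_inj hX0) => p.
rewrite !(itildeM hX0) (itilde_x0 hX0) -hE mulrCA; congr (_ * _).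
apply/polyP => i; rewrite mulrC coefMXn coef_drop_poly.
case: ltnP => [lt|le]; first by rewrite (coef_itilde hX0) hr // (germ0 hX0).
by rewrite subnK.
Qed.

Lemma compR_vanish f k (w : Rtilde X) :
    (forall p, itilde f p = 'X^k * w p) -> forall i, (i < k)%N -> compR i f = 0.
Proof.
move=> fE i lt; apply: (germ_inj hX0 (compR_homog i f)) => p.
by rewrite -(coef_itilde hX0) fE coefXnM lt.
Qed.

Variable sigma : Q -> Q.
Hypothesis hsigma : trace_map sigma.

(** This is the inclusion of [Rtilde] in the complementary module: r / x0^k is a sum of homogeneous
    elements of nonnegative degree. *)
Lemma complementary_x0frac r k :
  (forall i, (i < k)%N -> compR i r = 0) -> complementary_module sigma (x0frac r k).
Proof.
move=> hr; rewrite (compR_sum (leqnn (msize (repr r)))) (x0frac_sum hX0).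
apply: (complementary_sum hX0 hsigma (e := fun i : 'I_ _ => (i - k)%N)) => i.
(* For i < k the truncated difference does no harm, since the component is 0 and 0 has every
   degree. *)
have [lt|le] := ltnP i k.
  rewrite hr // -(x0fracP hX0 (q := toQh 0)).
    by apply: (gradQ_toQh hX0); exact: homogR0.
  by rewrite toQh0 mulr0.
rewrite -subzn //; apply: (gradQ_x0frac hX0); exact: compR_homog.
Qed.

Lemma complementary1 : complementary_module sigma 1.
Proof.
rewrite (x0fracP hX0 (q := 1) (f := 1) (k := 0)); first exact: complementary_x0frac.
by rewrite expr0 mulr1.
Qed.

(** The elements of degree 0 span [Qh] over [L0], so nondegeneracy can be tested on them. *)
Lemma sigma_degree0 a :
    (forall d f, homogR d f -> sigma (a * x0frac f d) = 0) -> a = 0.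
Proof.
move=> h; apply: (sigma_nondegenerate hsigma) => q.
have [y [k ->]] := Qh_x0frac hX0 q.
have L0x j : L0 (toQh (x0 ^+ j)) by apply: L0_toQh; exact: Kx0_x0.
apply: (x0_cancel0 hX0 (k := k)).
rewrite -(sigmaZ hsigma _ (L0x k)) mulrCA (mul_x0frac hX0).
rewrite (compR_sum (leqnn (msize (repr y)))) toQh_sum mulr_sumr (sigma_sum hsigma).
apply: big1 => i _; rewrite -(mul_x0frac hX0 (compR i y) i) mulrCA.
rewrite (sigmaZ hsigma _ (L0x i)) h ?mulr0 //; exact: compR_homog.
Qed.

(* With a = toQh g * c and b of degree 0, the product toQh g * b lies in R, so
   sigma (a * b) lies in R; its components of negative degree vanish. *)
Lemma conductor_mul_complementary g c r k :
    conductor (itilde g) -> complementary_module sigma c ->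
    toQh g * c = x0frac r k ->
  forall i, (i < k)%N -> compR i r = 0.
Proof.
move=> cg Cc aE i lt.
suff : x0frac (compR i r) k = 0.
  move=> /(congr1 (fun z => toQh (x0 ^+ k) * z)); rewrite mulr0 (mul_x0frac hX0).
  by rewrite -(toQh0 X) => /(toQh_inj (X := X)).
apply: sigma_degree0 => d y hy; set b := x0frac y d.
have [h hE] : exists h, toQh g * b = toQh h.
  apply: conductor_mul_x0frac => // j lj.
  by rewrite (compR_ne hy) // gtn_eqF.
have [v vE] := complementary_value h Cc.
(* D exceeds i, so that the component i of r is among the summands. *)
pose D := (i.+1 + msize (repr r))%N.
have sumE : \sum_(j < D) sigma (x0frac (compR j r) k * b) = toQh v.
  rewrite -vE -hE mulrCA mulrA aE.
  rewrite [in RHS](compR_sum (leq_addl _ _ : (msize (repr r) <= D)%N)).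
  by rewrite (x0frac_sum hX0) mulr_suml (sigma_sum hsigma).
have hgr (j : 'I_D) : gradQ (j%:Z - k%:Z) (sigma (x0frac (compR j r) k * b)).
  apply: (sigma_grad hsigma); rewrite -[X in gradQ X]addr0 -(subrr d%:Z).
  by apply: gradQM; apply: (gradQ_x0frac hX0) => //; exact: compR_homog.
have /choice[M MP] (j : 'I_D) := gradQP (hgr j).
(* One power x0^N clears all the values of sigma; N >= k makes N + j - k an honest difference. *)
have [N le_kN MN] : exists2 N, (k <= N)%N & forall j, (M j <= N)%N.
  exists (k + \max_j M j)%N => [|j]; first exact: leq_addr.
  by rewrite (leq_trans (leq_bigmax j)) // leq_addl.
have /choice[u uP] (j : 'I_D) : exists u, homogR (N + j - k) u /\
    toQh (x0 ^+ N) * sigma (x0frac (compR j r) k * b) = toQh u.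
  have [e eE [u hu uE]] := MP j N (MN j).
  exists u; split=> //; suff <- : e = (N + j - k)%N by [].
  have [<-] : (e + k)%N = (N + j)%N :> int; last by rewrite addnK.
  by rewrite !PoszD -[e%:Z](subrK N%:Z) eE; ring.
have sumu : \sum_j u j = x0 ^+ N * v.
  apply: (toQh_inj (X := X)); rewrite toQh_sum toQhM -sumE mulr_sumr.
  by apply: eq_bigr => j _; case: (uP j).
have iD : (i < D)%N by rewrite ltnS leq_addr.
have kN (j : nat) : (k <= N + j)%N by exact: leq_trans le_kN (leq_addr _ _).
apply: (x0_cancel0 hX0 (k := N)); rewrite (uP (Ordinal iD)).2 /=.
suff -> : u (Ordinal iD) = 0 by rewrite toQh0.
rewrite -(compR_id (uP (Ordinal iD)).1) /=.
(* Since i < k, this degree is below N, where x0^N v has no component; on the left only the summand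
   of index i has this degree. *)
have := congr1 (compR (N + i - k)) sumu.
rewrite (compRM_lt _ (homogR_x0 X N)); last first.
  by rewrite ltn_subLR // addnC ltn_add2r.
rewrite raddf_sum (bigD1 (Ordinal iD)) //= big1 ?addr0 // => j ne.
apply: (compR_ne (uP j).1); apply: contra ne => /eqP e; apply/eqP/val_inj => /=.
by apply/eqP; rewrite -(eqn_add2l N) -(subnK (kN j)) -(subnK (kN i)) e.
Qed.

(** The factor g moves c into [Rtilde], and f moves the result into R. *)
Lemma conductor_mul_dedekind f g : conductor (itilde f) -> conductor (itilde g) ->
  dedekind_different sigma (toQh (f * g)).
Proof.
move=> cf cg c Cc.
have [r [k aE]] := Qh_x0frac hX0 (toQh g * c).
rewrite toQhM -mulrA aE; apply: conductor_mul_x0frac => //.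
exact: conductor_mul_complementary aE.
Qed.

Lemma conductor_itilde (z : Rtilde X) : conductor z -> exists f, z = itilde f.
Proof.
move=> /(_ (fun=> 1))[f fE]; exists f; apply: functional_extensionality_dep => p.
by rewrite -fE mulr1.
Qed.

Lemma conductor_square_sub (v : Rtilde X) : conductor_square v ->
  exists f, (forall p, itilde f p = v p) /\ dedekind_different sigma (toQh f).
Proof.
move=> [m [z [w [zw vE]]]].
have /choice[F FP] (j : 'I_m) : exists f, z j = itilde f.
  by apply: conductor_itilde; case: (zw j).
have /choice[G GP] (j : 'I_m) : exists f, w j = itilde f.
  by apply: conductor_itilde; case: (zw j).
exists (\sum_j F j * G j); split=> [p|c Cc].
  rewrite vE (itilde_sum hX0); apply: eq_bigr => j _.
  by rewrite (itildeM hX0) FP GP.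
have /choice[H HP] (j : 'I_m) : exists h, toQh (F j * G j) * c = toQh h.
  by case: (zw j); rewrite FP GP => cF cG; exact: conductor_mul_dedekind.
exists (\sum_j H j); rewrite !toQh_sum mulr_suml.
exact: eq_bigr.
Qed.

Lemma dedekind_sub_conductor q : dedekind_different sigma q ->
  exists f, toQh f = q /\ conductor (itilde f).
Proof.
(* As 1 is in the complementary module, q itself lies in R; the same argument with w in place of 1
   puts q w in R. *)
move=> dq; have [f fE] := dq _ complementary1.
rewrite mulr1 in fE; exists f; split=> // w.
have [k [r rE]] := itilde_surj hX0 w.
have [h hE] := dq _ (complementary_x0frac (compR_vanish rE)).
have frE : f * r = x0 ^+ k * h.
  by apply: (toQh_inj (X := X)); rewrite !toQhM -hE fE mulrCA (mul_x0frac hX0).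
exists h => p.
(* The identity is checked after multiplication by X^k, which brings w into R, and X^k is then
   cancelled coefficientwise. *)
have : 'X^k * (itilde f p * w p) = 'X^k * itilde h p.
  by rewrite mulrCA -rE -(itildeM hX0) frE (itildeM hX0) (itilde_x0 hX0).
move=> /polyP e; apply/polyP => i; have := e (i + k)%N.
by rewrite !coefXnM ltnNge leq_addl /= addnK.
Qed.

End Conductor.

(* Both ideals lie in R, which embeds in Rtilde by itilde and in Qh by toQh;
   they are compared there. *)
Theorem proposition5p3 (K : fieldType) (n : nat) (X : zerodim_subscheme K n)
    (hG : locally_gorenstein X) (hX0 : avoids_X0 X)
    (sigma : Qh X -> Qh X) (hsigma : trace_map sigma) :
  (forall v : Rtilde X, conductor_square v ->
     exists f : coord_ring X,
       (forall p, itilde f p = v p) /\ dedekind_different sigma (toQh f)) /\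
  (forall q : Qh X, dedekind_different sigma q ->
     exists f : coord_ring X, toQh f = q /\ conductor (itilde f)).
Proof.
split=> [v|q].
  exact: conductor_square_sub.
exact: dedekind_sub_conductor.
Qed.
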